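(* For Lebesgue-almost all $(\beta_1,\beta_2)\in(0,0.649)\times(0,0.649)$ with $\beta_1+\beta_2\ge 1$ and $\beta_1\beta_2\ge 1/4$, there exists an $f_{\beta_1,\beta_2}$-ergodic Borel probability measure on $[-1,1]^2$ that is absolutely continuous (with respect to two-dimensional Lebesgue measure).
   Context: For $\beta_1,\beta_2\in(0,1)$ the generalized Baker's transformation $f_{\beta_1,\beta_2}:[-1,1]^2\to[-1,1]^2$ is defined by $$f_{\beta_1,\beta_2}(x,y)=\begin{cases}(\beta_1x+(1-\beta_1),\,2y-1)&\text{if }y\ge 0,\\(\beta_2x-(1-\beta_2),\,2y+1)&\text{if }y<0.\end{cases}$$ An $f$-ergodic measure is an $f$-invariant ergodic Borel probability measure. *)

(* Defs.v *)
From HB Require Import structures.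
From mathcomp Require Import all_boot all_order all_algebra.
From mathcomp Require Import all_classical all_reals all_analysis.

Set Implicit Arguments.
Unset Strict Implicit.
Unset Printing Implicit Defensive.

Import Order.TTheory GRing.Theory Num.Theory.
Import numFieldNormedType.Exports.

Local Open Scope classical_set_scope.
Local Open Scope ring_scope.

(* The sigma-algebra on the product is the Borel one: the product of the
   Borel sigma-algebras of the two real lines. *)
Notation plane R := (measurableTypeR R * measurableTypeR R)%type.

Notation lebesgue2 R := (@lebesgue_measure R \x @lebesgue_measure R)%E.

Definition square (R : realType) : set (plane R) := `[-1, 1] `*` `[-1, 1].

(* Only the restriction of [baker] to [square] matters; it maps [square] into
   itself when b1 and b2 lie in [0, 1]. *)
Definition baker (R : realType) (b1 b2 : R) (p : plane R) : plane R :=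
  if 0 <= p.2 then (b1 * p.1 + (1 - b1), 2 * p.2 - 1)
  else (b2 * p.1 - (1 - b2), 2 * p.2 + 1).

(* A Borel probability measure on X is represented by a probability measure mu
   on the ambient space with mu X = 1. The map is viewed as f : X -> X, so the
   preimage of A `<=` X is X `&` f @^-1` A. *)
Section ergodic_measures.
Context d (T : measurableType d) (R : realType).
Variables (X : set T) (f : T -> T) (mu : probability T R).

Definition invariant_on :=
  forall A, measurable A -> A `<=` X -> mu (X `&` f @^-1` A) = mu A.

Definition ergodic_on :=
  forall A, measurable A -> A `<=` X -> X `&` f @^-1` A = A ->
    mu A = 0%E \/ mu A = 1%E.

Definition ergodic_measure_on := [/\ mu X = 1%E, invariant_on & ergodic_on].

End ergodic_measures.

(* Main.v *)
Require Import Defs.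
From HB Require Import structures.
From mathcomp Require Import all_boot all_order all_algebra.
From mathcomp Require Import all_classical all_reals all_analysis.
From mathcomp Require Import measurable_realfun.
From mathcomp Require Import ring lra.
Set Implicit Arguments.
Unset Strict Implicit.
Unset Printing Implicit Defensive.
Import Order.TTheory GRing.Theory Num.Theory.
Import numFieldNormedType.Exports.
Local Open Scope classical_set_scope.
Local Open Scope ring_scope.

(** Under [baker b1 b2] the second coordinate moves by the doubling map of
    [-1, 1]. For the uniform distribution the signs of its iterates are fair
    coin tosses, and each toss selects the contraction x |-> b1 x + (1 - b1)
    or x |-> b2 x - (1 - b2) which acts on the first coordinate. Let nu be the
    law of the point obtained by composing these contractions along an
    infinite sequence of tosses. Then the product of nu and the uniform
    distribution is invariant. Coin sequences are represented here by uniform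
    points u of [-1, 1[, and nu is the law of [coded_point b1 b2 u]. The map
    (u, y) |-> (coded_point u, y) carries the area preserving map
    [coin_baker] to [baker b1 b2]; so the product measure is ergodic because
    [coin_baker] is ([coin_baker_ergodic]), and by Fubini it is absolutely
    continuous as soon as nu is. What remains is the absolute continuity of
    nu for almost all parameters ([ae_code_law_ac]).

    The main tool is transversality. If two words of letters first differ
    after a common prefix, the distance of the points that they code is, up
    to a bounded factor, the contraction ratio of the prefix times the modulus
    of a power series 1 + a_1 X + a_2 X^2 + ... with all a_j in [-1, 1]; along
    the ray of parameters (r, c r) one has X = max(1, c) r. A series of this
    kind that has come close to zero below 649/1000 keeps decreasing with a
    definite slope ([transversality]). Integrating over rays, the parameters
    for which the two points are within s of each other have area O(s / ratio
    of the prefix) ([lebesgue2_overlap_le]).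

    Summing over the second word gives for each word w the bound s times
    [weight w], which is the sum of 2^-n / ratio over the prefixes of w; here
    the ratios are computed at the lower corner (l1, l2) of a box of
    parameters ([sum_overlap_le]). If l1 l2 > 1/4, these terms decay
    exponentially along typical words, although their mean need not. Their
    m-th roots have an exponentially decaying mean when m is large
    ([small_roots]), so all words but a small proportion have weight at most
    M ([sum_weight_le], [weight_exp]). On these words the mean number of
    collisions at scale rho, divided by rho, has an integral over the box that
    is bounded independently of rho ([integral_energy_le]). By Fatou's lemma
    it is therefore bounded, for almost every parameter, along a sequence of
    scales that tends to zero. At these scales most points u have
    nu-mass O(rho) within distance rho of their image, which forces nu to be
    absolutely continuous ([null_preimage_of_thin]).

    Countably many boxes cover the region b1 b2 > 1/4, and the curve
    b1 b2 = 1/4 is a null set. *)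

(** * Transversality of power series with bounded coefficients *)

Section transversality.
Context {R : realFieldType}.
Implicit Types x y z t : R.

(** Solomyak's comparison function: the coefficients are -1 in degrees 1 to 3
    and 1 from degree 5 on. The coefficient of degree 4 has to lie between
    about 0.0875 and 0.0913, so that at 649/1000 the value is still positive
    and the slope already negative; 1/5000 is a margin for both. *)
Definition star z : R :=
  1 - z - z ^+ 2 - z ^+ 3 + 179 / 2000 * z ^+ 4 + z ^+ 5 / (1 - z).

(** This is the slope of [z |-> star z + z / 5000] between x and y, multiplied
    by (1 - x) (1 - y). It nearly vanishes when x = y = 649/1000, so it is
    expanded in the distances p and q to this corner, where the linear terms
    dominate. *)
Lemma star_slope_numerator x y : 0 <= x <= 649 / 1000 -> 0 <= y <= 649 / 1000 ->
  (- (1 - 1 / 5000) - (x + y) - (x ^+ 2 + x * y + y ^+ 2)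
   + 179 / 2000 * (x ^+ 3 + x ^+ 2 * y + x * y ^+ 2 + y ^+ 3))
    * ((1 - x) * (1 - y))
  + (x ^+ 4 + x ^+ 3 * y + x ^+ 2 * y ^+ 2 + x * y ^+ 3 + y ^+ 4)
  - x * y * (x ^+ 3 + x ^+ 2 * y + x * y ^+ 2 + y ^+ 3) <= 0.
Proof.
move=> /andP[x0 x1] /andP[y0 y1].
have [p [p0 p1 xE]] : exists p, [/\ 0 <= p, p <= 649/1000 & x = 649/1000 - p].
  by exists (649/1000 - x); split; lra.
have [q [q0 q1 yE]] : exists q, [/\ 0 <= q, q <= 649/1000 & y = 649/1000 - q].
  by exists (649/1000 - y); split; lra.
rewrite {}xE {}yE {x y x0 x1 y0 y1}.
(* The pure powers of p in the expansion, with coefficients rounded up. *)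
have A z : 0 <= z -> z <= 649/1000 ->
    - 18/10 * z + 234/100 * z ^+ 2 - 141/100 * z ^+ 3
     + 32/100 * z ^+ 4 <= - (4/10) * z.
  move=> z0 z1.
  have : z * (- 18/10 + 234/100 * z - 141/100 * z ^+ 2
     + 32/100 * z ^+ 3 + 4/10) <= 0; last by lra.
  apply: (mulr_ge0_le0 z0).
  have : 234/100 * z - 141/100 * z ^+ 2 <= 234/100 * (649/1000) - 141/100 * (649/1000) ^+ 2 by nra.
  have : z ^+ 3 <= (649/1000) ^+ 3 by rewrite lerXn2r// nnegrE; lra.
  lra.
(* The cofactor of p q in the expansion, with coefficients rounded up. *)
have B : - 29/10 + 525/100 * (p + q)
    - 372/100 * (p ^+ 2 + p * q + q ^+ 2)
    + 92/100 * (p ^+ 3 + p ^+ 2 * q + p * q ^+ 2 + q ^+ 3) <= 4 / 10.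
  have p2 : p ^+ 2 <= 649/1000 * p by rewrite expr2 ler_wpM2r.
  have q2 : q ^+ 2 <= 649/1000 * q by rewrite expr2 ler_wpM2r.
  have -> : p ^+ 3 + p ^+ 2 * q + p * q ^+ 2 + q ^+ 3 = (p + q) * (p ^+ 2 + q ^+ 2) by ring.
  have : (p + q) * (p ^+ 2 + q ^+ 2) <= (p + q) * (649/1000 * (p + q)).
    by apply: ler_wpM2l; lra.
  have : 0 <= (p - q) ^+ 2 by rewrite sqr_ge0.
  have : 0 <= ((p + q) - 12/10) ^+ 2 by rewrite sqr_ge0.
  lra.
have pq0 : 0 <= p * q by rewrite mulr_ge0.
have pq1 : p * q <= 649/1000 * q by rewrite ler_wpM2r.
have pq2 : p * q <= 649/1000 * p by rewrite mulrC ler_wpM2r.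
have := ler_wpM2l pq0 B.
have := A _ p0 p1; have := A _ q0 q1.
have : 0 <= p^+3 by rewrite exprn_ge0.
have : 0 <= q^+3 by rewrite exprn_ge0.
have : 0 <= p^+2 by rewrite exprn_ge0.
have : 0 <= q^+2 by rewrite exprn_ge0.
have : 0 <= p^+4 by rewrite exprn_ge0.
have : 0 <= q^+4 by rewrite exprn_ge0.
have : 0 <= p^+2*q by rewrite mulr_ge0// exprn_ge0.
have : 0 <= p*q^+2 by rewrite mulr_ge0// exprn_ge0.
have : 0 <= p^+2*q^+2 by rewrite mulr_ge0// exprn_ge0.
have : 0 <= p^+3*q by rewrite mulr_ge0// exprn_ge0.
have : 0 <= p*q^+3 by rewrite mulr_ge0// exprn_ge0.
have : 0 <= p^+4*q by rewrite mulr_ge0// exprn_ge0.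
have : 0 <= p*q^+4 by rewrite mulr_ge0// exprn_ge0.
have : 0 <= p^+3*q^+2 by rewrite mulr_ge0// exprn_ge0.
have : 0 <= p^+2*q^+3 by rewrite mulr_ge0// exprn_ge0.
lra.
Qed.

Lemma star_decr x y : 0 <= x -> x <= y -> y <= 649 / 1000 ->
  star y <= star x - 1 / 5000 * (y - x).
Proof.
move=> x0 xy y1.
have xI : 0 <= x <= 649 / 1000 by lra.
have yI : 0 <= y <= 649 / 1000 by lra.
have := star_slope_numerator xI yI; set K := (X in X <= 0) => K0.
suff -> : star y = star x - 1 / 5000 * (y - x) + (y - x) * K / ((1 - x) * (1 - y)).
  rewrite gerDl mulr_le0_ge0//; first by rewrite mulr_ge0_le0// subr_ge0.
  by rewrite invr_ge0; apply: mulr_ge0; lra.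
rewrite /star /K; field.
by apply/andP; split; apply/eqP; lra.
Qed.

Lemma star_ge x : 0 <= x <= 649 / 1000 -> 1 / 5000 <= star x.
Proof.
move=> /andP[x0 x1].
have := @star_decr x (649 / 1000) x0 x1 (lexx _).
have : 1 / 5000 <= star (649/1000 : R).
  rewrite /star; have -> : 1 - 649/1000 = 351/1000 :> R by lra.
  by rewrite invf_div; lra.
by move: x0 x1; lra.
Qed.

Lemma geom_tail n z : 1 - z != 0 ->
  z ^+ 5 / (1 - z) = \sum_(j < n) z ^+ (j + 5) + z ^+ (n + 5) / (1 - z).
Proof.
move=> z1; elim: n => [|n IH]; first by rewrite big_ord0 add0r add0n.
rewrite big_ord_recr/= IH -addrA; congr (_ + _).
by rewrite addSn (exprS z (n + 5)); field.
Qed.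

Definition powser n (a : nat -> R) z : R := \sum_(j < n) a j * z ^+ j.+1.

(** Trailing zero coefficients make the degrees up to 4 available, which
    [star] treats separately. *)
Lemma powser_pad n a z :
  powser n a z = powser (n + 4) (fun j => if (j < n)%N then a j else 0) z.
Proof.
rewrite /powser big_split_ord/= [X in _ = _ + X]big1 ?addr0 => [|i _].
  by apply: eq_bigr => i _; rewrite ltn_ord.
by rewrite ltnNge leq_addr/= mul0r.
Qed.

(** The difference f of the series and [star] has coefficients >= 0 below
    degree 4 and <= 0 above it, so f (t x) <= t^4 f x for t >= 1: once f is
    nonpositive it decreases. Since [star] itself decreases with slope below
    -1/5000 and stays above 1/5000, a series that has come below 1/5000
    decreases at least as fast. *)
Lemma transversality n a x y : (forall j, `|a j| <= 1) ->
  0 <= x -> x <= y -> y <= 649 / 1000 ->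
  1 + powser n a x <= 1 / 5000 ->
  powser n a y <= powser n a x - 1 / 5000 * (y - x).
Proof.
move=> a1 x0 xy y1.
rewrite !(powser_pad n); set b := fun j => _.
have {a1}b1 j : `|b j| <= 1 by rewrite /b; case: ifP => // _; rewrite normr0.
move: b b1 => {}a a1; have a1P j : a j <= 1 := ler_normlW (a1 j).
have a1N j : 0 <= 1 + a j.
  by rewrite -lerBlDl sub0r; have := a1 j; rewrite ler_norml => /andP[].
have sx : 1 / 5000 <= star x by apply: star_ge; rewrite x0 (le_trans xy y1).
have sy := star_decr x0 xy y1.
have d1 : 1 / 5000 < 1 :> R by lra.
have {}y1 : y < 1 by apply: le_lt_trans y1 _; lra.
have x1 : x < 1 := le_lt_trans xy y1.
move: (1 / 5000 : R) sx sy d1 => d sx sy d1 phix.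
have [x00|xpos] := eqVneq x 0.
  have p0 : powser (n + 4) a x = 0.
    by rewrite x00 /powser big1// => i _; rewrite expr0n/= mulr0.
  by move: phix; rewrite p0 addr0 leNgt d1.
have {}x0 : 0 < x by rewrite lt_def xpos.
pose f z := 1 + powser (n + 4) a z - star z.
have fE z : 1 - z != 0 -> f z =
    (1 + a 0%N) * z + (1 + a 1%N) * z ^+ 2 + (1 + a 2%N) * z ^+ 3
    + (a 3%N - 179/2000) * z ^+ 4
    - (\sum_(j < n) (1 - a (j + 4)%N) * z ^+ (j + 5) + z ^+ (n + 5) / (1 - z)).
  move=> z1; rewrite /f /star (geom_tail n z1) /powser addnC big_split_ord/=.
  have -> : \sum_(j < n) (1 - a (j + 4)%N) * z ^+ (j + 5) =
      \sum_(j < n) z ^+ (j + 5) - \sum_(j < n) a (j + 4)%N * z ^+ (j + 5).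
    by rewrite -sumrB; apply: eq_bigr => j _; rewrite mulrBl mul1r.
  rewrite !big_ord_recl big_ord0 /= /bump/=.
  have -> : \sum_(j < n) a (4 + j)%N * z ^+ (4 + j).+1 =
      \sum_(j < n) a (j + 4)%N * z ^+ (j + 5).
    by apply: eq_bigr => j _; rewrite addnC -addnS.
  by rewrite !add1n; ring.
pose t := y / x.
have t1 : 1 <= t by rewrite /t ler_pdivlMr// mul1r.
have t0 : 0 <= t by apply: le_trans t1.
have yE : y = t * x by rewrite /t divfK// gt_eqF.
move: t t1 t0 yE => t t1 t0 yE.
have pos m : 0 <= x ^+ m by rewrite exprn_ge0// ltW.
have low m c : (m <= 4)%N -> 0 <= c -> c * y ^+ m <= t ^+ 4 * (c * x ^+ m).
  by move=> m4 c0; rewrite yE exprMn (mulrCA c) ler_wpM2r ?ler_weXn2l// mulr_ge0.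
have high m c : (4 <= m)%N -> 0 <= c -> t ^+ 4 * (c * x ^+ m) <= c * y ^+ m.
  by move=> m4 c0; rewrite yE exprMn (mulrCA c) ler_wpM2r ?ler_weXn2l// mulr_ge0.
have fy : f y <= t ^+ 4 * f x.
  rewrite !fE ?subr_eq0 ?(gt_eqF x1) ?(gt_eqF y1)//.
  have e4 : (a 3%N - 179/2000) * y ^+ 4 = t ^+ 4 * ((a 3%N - 179/2000) * x ^+ 4).
    by rewrite yE exprMn mulrCA.
  rewrite mulrBr !mulrDr e4 lerB//; last rewrite mulr_sumr lerD//.
  - rewrite lerD2r; do 2 (apply: lerD; last exact: low).
    by have := @low 1%N (1 + a 0%N); rewrite !expr1; apply.
  - by apply: ler_sum => j _; apply: high; rewrite ?addnS// subr_ge0.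
  - have h5 : (4 <= n + 5)%N by rewrite addnS ltnW// ltnS leq_addl.
    have := @high (n + 5)%N 1 h5 ler01; rewrite !mul1r => h.
    have [x10 y10] : 0 < 1 - x /\ 0 < 1 - y by rewrite !subr_gt0.
    rewrite mulrA; apply: ler_pM => //.
    + by rewrite mulr_ge0// exprn_ge0.
    + by rewrite invr_ge0 ltW.
    + by rewrite lef_pV2 ?posrE// lerD2l lerN2.
have fx : f x <= 0 by rewrite subr_le0 (le_trans phix).
have fyx : f y <= f x.
  apply: le_trans fy _; rewrite -subr_ge0 -{1}[f x]mul1r -mulrBl mulr_le0//.
  by rewrite subr_le0 exprn_ege1.
move: fyx sy; rewrite /f {fE fy fx sx phix}.
by move: (powser _ _ x) (powser _ _ y) (star x) (star y) => *; lra.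
Qed.

(** The series crosses the band [-s, s] with slope below -1/5000, hence within
    length 10000 s. If s > 1/5000 the bound exceeds the length of the
    interval. *)
Lemma transversality_diam n a x y s : (forall j, `|a j| <= 1) ->
  0 <= x <= 649 / 1000 -> 0 <= y <= 649 / 1000 ->
  `|1 + powser n a x| <= s -> `|1 + powser n a y| <= s -> `|x - y| <= 10000 * s.
Proof.
move=> a1 xI yI xs ys.
have s0 : 0 <= s by apply: le_trans xs.
have [sd|sd] := leP s (1/5000); last by rewrite ler_norml; lra.
wlog xy : x y xI yI xs ys / x <= y.
  move=> H; have [xy|yx] := leP x y; first exact: H.
  by rewrite distrC H// ltW.
move: xs ys; rewrite !ler_norml => /andP[xs1 xs2] /andP[ys1 ys2].
have := @transversality n a x y a1.
case/andP: xI yI => x0 x1 /andP[y0 y1] /(_ x0 xy y1).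
by move=> T; have {}T := T (le_trans xs2 sd); lra.
Qed.

End transversality.

(** * Codes of finite words *)

Section words.
Context {R : realFieldType}.
Implicit Types (r c : R) (w : seq bool).

Fixpoint words n : seq (seq bool) :=
  if n is n'.+1 then map (cons true) (words n') ++ map (cons false) (words n')
  else [:: [::]].

(** The letter [true] stands for T1 x = b1 x + (1 - b1) and [false] for
    T2 x = b2 x - (1 - b2). Composing the contractions of w, the first letter
    being applied last, sends 1 to 1 - 2 (1 - b2) code w. As T1 fixes 1, only
    the letters [false] contribute a term. *)
Fixpoint code (b1 b2 : R) w : R :=
  if w is s :: w' then
    if s then b1 * code b1 b2 w' else 1 + b2 * code b1 b2 w'
  else 0.

Lemma size_words n w : w \in words n -> size w = n.
Proof.
elim: n w => [|n IH] w /=; first by rewrite inE => /eqP ->.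
by rewrite mem_cat => /orP[] /mapP[v /IH <- ->].
Qed.

Lemma big_words n (F : seq bool -> R) :
  \sum_(w <- words n.+1) F w =
  \sum_(w <- words n) F (true :: w) + \sum_(w <- words n) F (false :: w).
Proof. by rewrite /= big_cat !big_map. Qed.

Lemma sum_words_cst c n : \sum_(w <- words n) c = 2 ^+ n * c.
Proof.
elim: n => [|n IH]; first by rewrite big_seq1 expr0 mul1r.
by rewrite big_words IH exprS -mulrA mulr_natl mulr2n.
Qed.

(** On the ray (r, c r) a letter multiplies by r or c r, that is by
    X = max(1, c) r times a factor in [0, 1]. *)
Lemma code_powser c w : 0 <= c -> exists q : nat -> R,
  (forall j, 0 <= q j <= 1) /\
  forall r, code r (c * r) w =
            \sum_(j < size w) q j * (Num.max 1 c * r) ^+ j.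
Proof.
move=> c0; have m0 : 0 < Num.max 1 c by rewrite lt_max ltr01.
elim: w => [|s w [q [q01 qE]]].
  by exists (fun=> 0); split => [j|r]; rewrite ?lexx ?ler01// big_ord0.
have kappa u : 0 <= u -> u <= Num.max 1 c ->
    forall j, 0 <= u / Num.max 1 c * q j <= 1.
  move=> u0 um j; case/andP: (q01 j) => qj0 qj1.
  rewrite mulr_ge0 ?divr_ge0 ?(ltW m0)//= mulr_ile1// ?divr_ge0 ?(ltW m0)//.
  by rewrite ler_pdivrMr// mul1r.
have step u r : u * r * code r (c * r) w =
    \sum_(j < size w) u / Num.max 1 c * q j * (Num.max 1 c * r) ^+ j.+1.
  rewrite qE mulr_sumr; apply: eq_bigr => j _; rewrite exprS.
  by field; rewrite gt_eqF.
case: s; [exists (fun j => if j is j'.+1 then 1 / Num.max 1 c * q j' else 0)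
         |exists (fun j => if j is j'.+1 then c / Num.max 1 c * q j' else 1)].
- split=> [[|j]|r]; first by rewrite lexx ler01.
  + by apply: kappa; rewrite ?le_max ?lexx.
  + by rewrite /= big_ord_recl/= mul0r add0r -step mul1r.
- split=> [[|j]|r]; first by rewrite lexx ler01.
  + by apply: kappa; rewrite ?le_max ?lexx ?orbT.
  + by rewrite /= big_ord_recl/= expr0 mulr1 -step.
Qed.

Lemma code_diff_powser n c w w' : 0 <= c -> size w = n -> size w' = n ->
  exists a : nat -> R, (forall j, `|a j| <= 1) /\
  forall r, code r (c * r) (false :: w') - code r (c * r) (true :: w) =
            1 + powser n a (Num.max 1 c * r).
Proof.
move=> c0 wn w'n.
have [q [q01 qE]] := code_powser (true :: w) c0.
have [q' [q'01 q'E]] := code_powser (false :: w') c0.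
(* The constant coefficients are read off at r = 0. *)
have q00 : q 0%N = 0.
  have := qE 0; rewrite mulr0 /= mul0r big_ord_recl expr0 mulr1 mulr0 big1 => [|i _].
    by rewrite addr0.
  by rewrite exprS !mul0r mulr0.
have q'00 : q' 0%N = 1.
  have := q'E 0; rewrite mulr0 /= mul0r addr0 big_ord_recl expr0 mulr1 mulr0 big1 => [|i _].
    by rewrite addr0.
  by rewrite exprS !mul0r mulr0.
exists (fun j => q' j.+1 - q j.+1); split => [j|r].
  have := q01 j.+1; have := q'01 j.+1; rewrite ler_norml; lra.
rewrite qE q'E /= wn w'n !big_ord_recl q00 q'00 !expr0 /powser mul0r mulr1 add0r.
rewrite -addrA -sumrB; congr (_ + _); apply: eq_bigr => j _.
by rewrite mulrBl.
Qed.

(** Twice the inverse of the slope in [transversality]. It is made opaque so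
    that tactics do not unfold the numeral. *)
Definition diam_const : R := 10000.

Lemma diam_const_ge0 : 0 <= diam_const.
Proof. exact: ler0n. Qed.

Lemma code_diff_diam n c w w' r r' s : 0 <= c -> size w = n -> size w' = n ->
  0 <= r -> r <= 649 / 1000 -> c * r <= 649 / 1000 ->
  0 <= r' -> r' <= 649 / 1000 -> c * r' <= 649 / 1000 ->
  `|code r (c * r) (false :: w') - code r (c * r) (true :: w)| <= s ->
  `|code r' (c * r') (false :: w') - code r' (c * r') (true :: w)| <= s ->
  `|r - r'| <= diam_const * s.
Proof.
move=> c0 wn w'n r0 r1 cr r'0 r'1 cr'.
have [a [a1 aE]] := code_diff_powser c0 wn w'n.
rewrite !aE => rs r's.
have m1 : 1 <= Num.max 1 c by rewrite le_max lexx.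
have mI u : 0 <= u -> u <= 649 / 1000 -> c * u <= 649 / 1000 ->
    0 <= Num.max 1 c * u <= 649 / 1000.
  move=> u0 u1 cu; rewrite mulr_ge0//=; last by apply: le_trans m1.
  by rewrite maxEle; case: ifP => //; rewrite mul1r.
have := transversality_diam a1 (mI r r0 r1 cr) (mI r' r'0 r'1 cr') rs r's.
apply: le_trans; rewrite -mulrBr normrM ler_peMl//.
by rewrite ger0_norm// (le_trans _ m1).
Qed.

End words.
Global Opaque diam_const.

(** * Weights of words *)

Section weights.
Context {R : realType}.
Implicit Types (w : seq bool).

(** The sum, over the proper prefixes of w, of the product of their letters
    when [true] counts a1 and [false] counts a2. For a1 = 1 / (2 l1) and
    a2 = 1 / (2 l2) the prefix of length n contributes 2^-n divided by its
    contraction ratio at the parameter (l1, l2). *)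
Fixpoint weight (a1 a2 : R) w : R :=
  if w is s :: w' then 1 + (if s then a1 else a2) * weight a1 a2 w' else 0.

Lemma weight_ge0 (a1 a2 : R) w : 0 <= a1 -> 0 <= a2 -> 0 <= weight a1 a2 w.
Proof.
by move=> a10 a20; elim: w => //= s w IH; rewrite addr_ge0// mulr_ge0//; case: s.
Qed.

(** A sum of (m+1)-st powers of nonnegative numbers is at most the (m+1)-st
    power of their sum. *)
Lemma weight_exp (a1 a2 : R) m w : 0 <= a1 -> 0 <= a2 ->
  weight (a1 ^+ m.+1) (a2 ^+ m.+1) w <= weight a1 a2 w ^+ m.+1.
Proof.
move=> a10 a20; elim: w => [|s w IH] /=; first by rewrite expr0n.
set a : R := if s then a1 else a2.
have a0 : 0 <= a by rewrite /a; case: ifP.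
have -> : (if s then a1 ^+ m.+1 else a2 ^+ m.+1) = a ^+ m.+1 by rewrite /a; case: ifP.
apply: (@le_trans _ _ (1 + (a * weight a1 a2 w) ^+ m.+1)).
  by rewrite lerD2l exprMn ler_wpM2l// exprn_ge0.
set z := a * _; have z0 : 0 <= z by rewrite mulr_ge0// weight_ge0.
clearbody z; elim: m {IH} => [|m IH]; first by rewrite !expr1.
rewrite exprS [in leRHS]exprS mulrDl mul1r lerD//.
  by rewrite exprn_ege1// lerDl.
by rewrite ler_wpM2l// (le_trans _ IH)// lerDr.
Qed.

(** For uniformly distributed letters the term of index n has mean
    ((a1 + a2) / 2)^n, so the mean weight is at most a geometric series. *)
Lemma sum_weight_le (a1 a2 : R) n : 0 <= a1 -> 0 <= a2 -> a1 + a2 < 2 ->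
  \sum_(w <- words n) weight a1 a2 w <= 2 ^+ n * (1 - (a1 + a2) / 2)^-1.
Proof.
move=> a10 a20 a12; set C := (X in _ * X).
have C0 : 0 <= C by rewrite invr_ge0; lra.
have CE : 1 + (a1 + a2) / 2 * C = C.
  by rewrite /C; field; apply/eqP; lra.
elim: n => [|n IH]; first by rewrite big_seq1 expr0 mul1r.
rewrite big_words /= !big_split/= !sum_words_cst mulr1 -!mulr_sumr addrACA -mulrDl.
rewrite exprS -mulrA -[C]CE.
have : (a1 + a2) * \sum_(w <- words n) weight a1 a2 w <= (a1 + a2) * (2 ^+ n * C).
  by rewrite ler_wpM2l// addr_ge0.
move/(le_trans _) => H.
rewrite [leRHS](_ : _ = 2 ^+ n + 2 ^+ n + (a1 + a2) * (2 ^+ n * C)).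
  by rewrite lerD2l ler_wpM2l// addr_ge0.
by field.
Qed.

Lemma expR_le_inv (t : R) : t < 1 -> expR t <= (1 - t)^-1.
Proof.
move=> t1; rewrite -[expR t]invrK -expRN lef_pV2 ?posrE ?expR_gt0 ?subr_gt0//.
by have := expR_ge1Dx (- t); rewrite addrC addrC.
Qed.

(** The k-th root of a is 1 + ln a / k + O(1 / k^2), so the sum of the roots is
    2 + ln (a1 a2) / k + O(1 / k^2), which is below 2 for large k. The
    error terms are controlled by exp t <= 1 / (1 - t). *)
Lemma small_roots (a1 a2 : R) : 0 < a1 -> 0 < a2 -> a1 * a2 < 1 ->
  exists m y1 y2, [/\ 0 <= y1, 0 <= y2, y1 + y2 < 2,
    y1 ^+ m.+1 = a1 & y2 ^+ m.+1 = a2].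
Proof.
move=> a10 a20 a12.
set a := ln a1; set b := ln a2.
have ab : a + b < 0 by rewrite -lnM// ln_lt0// mulr_gt0.
pose B := `|a| + `|b| + `|2 * a * b / (a + b)|.
pose m := Num.bound B.
have B0 : 0 <= B by rewrite !addr_ge0.
have mB : B < m.+1%:R.
  have := archi_boundP B0 => /lt_le_trans; apply.
  by rewrite ler_nat /m leqnSn.
set k : R := m.+1%:R; have k0 : 0 < k by rewrite ltr0n.
have ka : a < k.
  by apply: le_lt_trans mB; rewrite /B (le_trans (ler_norm a))// -addrA lerDl addr_ge0.
have kb : b < k.
  by apply: le_lt_trans mB; rewrite /B (le_trans (ler_norm b))// addrAC lerDr addr_ge0.
have kab : k * (a + b) < 2 * a * b.
  rewrite -ltr_ndivrMr//; apply: le_lt_trans mB.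
  by rewrite (le_trans (ler_norm _))// /B lerDr addr_ge0.
have rootE x : 0 < x -> expR (ln x / k) ^+ m.+1 = x.
  by move=> x0; rewrite -expRM_natl -/k mulrC divfK ?gt_eqF// lnK// posrE.
exists m, (expR (a / k)), (expR (b / k)); split;
  rewrite ?expR_ge0//; [|exact: rootE|exact: rootE].
apply: (@le_lt_trans _ _ ((1 - a / k)^-1 + (1 - b / k)^-1)).
  by apply: lerD; apply: expR_le_inv; rewrite ltr_pdivrMr// mul1r.
have -> : (1 - a / k)^-1 + (1 - b / k)^-1 = k * (2 * k - (a + b)) / ((k - a) * (k - b)).
  by field; rewrite !gt_eqF ?subr_gt0.
rewrite ltr_pdivrMr; last by rewrite mulr_gt0// subr_gt0.
have : k * (a + b) < 2 * a * b by [].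
nra.
Qed.

End weights.

(** * Lebesgue measure on the line *)

Section affine.
Context {R : realType}.
Local Notation leb := (@lebesgue_measure R).

Lemma lebesgue_affine (a c : R) (A : set R) : 0 < a -> measurable A ->
  leb ((fun x : R => a * x + c) @^-1` A) = (a^-1%:E * leb A)%E.
Proof.
move=> a0 mA.
pose f : measurableTypeR R -> measurableTypeR R := fun x => a * x + c.
have mf : measurable_fun setT f.
  by apply: measurable_funD => //; apply: measurable_funM.
have an0 : 0 <= a by exact: ltW.
pose m := mscale (NngNum an0) (pushforward leb f).
suff -> : leb A = m mf A.
  by rewrite /m /mscale/= /pushforward muleA -EFinM mulVf ?gt_eqF// mul1e.
apply: lebesgue_measure_unique mA => _ [[u v]] _ <-/=.
rewrite /m /mscale/= /pushforward/=.
have -> : f @^-1` `]u, v] = `](u - c) / a, (v - c) / a]%classic.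
  apply/seteqP; split=> x /=; rewrite /f !in_itv/= ltr_pdivrMr// ler_pdivlMr//;
  by rewrite ltrBlDr lerBrDr mulrC.
rewrite !lebesgue_measure_itv/= !lte_fin ltr_pM2r ?invr_gt0// ltrD2r.
case: ifP => _; last by rewrite mule0.
by rewrite -!EFinD -EFinM; congr (_%:E); field; rewrite gt_eqF.
Qed.

Lemma lebesgue_diam (d : R) (A : set R) : measurable A -> 0 <= d ->
  (forall x y, A x -> A y -> `|x - y| <= d) -> (leb A <= (2 * d)%:E)%E.
Proof.
move=> mA d0 Ad; have [->|/set0P[x Ax]] := eqVneq A set0.
  by rewrite measure0 lee_fin mulr_ge0.
apply: (@le_trans _ _ (leb `[x - d, x + d])).
  apply: le_measure; rewrite ?inE//.
  move=> y Ay; rewrite /= in_itv/=; have := Ad _ _ Ax Ay.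
  by rewrite ler_norml; lra.
rewrite lebesgue_measure_itv/= lte_fin; case: ifP => _.
  by rewrite -EFinD lee_fin; lra.
by rewrite lee_fin mulr_ge0.
Qed.

End affine.

(** * The parameters for which two codes are close *)

Section overlap.
Context {R : realType}.
Local Notation leb := (@lebesgue_measure R).
Implicit Types (w : seq bool).

Definition box (l1 l2 : R) : set (plane R) :=
  [set b | l1 <= b.1 <= 649 / 1000 /\ l2 <= b.2 <= 649 / 1000].

Definition overlap (l1 l2 : R) w w' (s : R) : set (plane R) :=
  box l1 l2 `&` [set b | `|code b.1 b.2 w - code b.1 b.2 w'| <= s].

Lemma measurable_box l1 l2 : measurable (box l1 l2).
Proof.
have -> : box l1 l2 = `[l1, 649/1000]%classic `*` `[l2, 649/1000]%classic.
  by apply/seteqP; split=> -[x y] /=; rewrite !in_itv.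
by apply: measurableX; exact: measurable_itv.
Qed.

Lemma measurable_code w : measurable_fun setT (fun b : plane R => code b.1 b.2 w).
Proof.
elim: w => [|[] w IH] /=; first exact: measurable_cst.
  by apply: measurable_funM => //; exact: measurable_fst.
apply: measurable_funD; first exact: measurable_cst.
by apply: measurable_funM => //; exact: measurable_snd.
Qed.

Lemma measurable_overlap l1 l2 w w' s : measurable (overlap l1 l2 w w' s).
Proof.
apply: measurableI; first exact: measurable_box.
have mf : measurable_fun setT (fun b : plane R => `|code b.1 b.2 w - code b.1 b.2 w'|).
  apply: measurableT_comp => //; apply: measurable_funB; exact: measurable_code.
have := mf measurableT _ (measurable_itv `]-oo, s]); rewrite setTI.
by congr measurable; apply/seteqP; split=> b /=; rewrite in_itv.
Qed.

(** In the coordinates (r, c) with b = (r, c r) the Jacobian r is at most 1, and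
    for fixed c the admissible r form a set of diameter O(s) by
    [code_diff_diam]. Only c in [0, 3] occur, as r >= 1/4 and c r < 3/4. *)
Lemma lebesgue2_overlap_le l1 l2 n w w' (s : R) :
  1 / 4 <= l1 -> 1 / 4 <= l2 -> size w = n -> size w' = n -> 0 <= s ->
  (lebesgue2 R (overlap l1 l2 (true :: w) (false :: w') s) <= (6 * (diam_const * s))%:E)%E.
Proof.
move=> l10 l20 wn w'n s0.
set E := overlap _ _ _ _ _.
have mE : measurable E by exact: measurable_overlap.
pose polar (p : plane R) : plane R := (p.1, p.1 * p.2).
have mpolar : measurable_fun setT polar.
  apply/measurable_fun_pairP; split; first exact: measurable_fst.
  by apply: measurable_funM; [exact: measurable_fst|exact: measurable_snd].
pose E' := polar @^-1` E.
have mE' : measurable E' by rewrite -[E']setTI; exact: mpolar.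
have EE' : (lebesgue2 R E <= lebesgue2 R E')%E.
  apply: ge0_le_integral => //; [exact: measurable_fun_xsection..|].
  move=> r _ /=.
  have [rI|rI] := boolP (l1 <= r <= 649 / 1000); last first.
    suff -> : xsection E r = set0 by rewrite measure0.
    apply/seteqP; split=> // x; rewrite /xsection/= inE => -[[/= H _] _].
    by rewrite H in rI.
  have r0 : 0 < r by move: rI; lra.
  have -> : xsection E' r = (fun x => r * x + 0) @^-1` xsection E r.
    by apply/seteqP; split=> x; rewrite /xsection/= !inE/= /E'/polar/= addr0.
  rewrite lebesgue_affine//; last exact: measurable_xsection.
  rewrite lee_pemull// lee_fin invf_ge1//; move: rI; lra.
apply: (le_trans EE').
rewrite -[leLHS]/((leb \x leb)%E E').
have -> : (leb \x leb)%E E' = (leb \x^ leb)%E E'.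
  by apply: product_measure_unique => // A B mA mB; exact: product_measure2E.
apply: (@le_trans _ _
  (\int[leb]_(c in `[0%R, 3%R]) (cst (2 * (diam_const * s))%:E) c)%E); last first.
  rewrite integral_cst//=.
  rewrite lebesgue_measure_itv/= lte_fin ltr0n/= -EFinD -EFinM lee_fin; lra.
rewrite /product_measure2 integral_mkcond [leRHS]integral_mkcond.
apply: ge0_le_integral => //.
- by move=> c _; rewrite patchE; case: ifP.
- apply/(measurable_restrictT _ _).1 => //; exact: measurable_fun_ysection.
- apply/(measurable_restrictT _ _).1 => //; exact: measurable_itv.
move=> c _; rewrite !patchE in_setT; case: ifPn => cI.
  rewrite [leRHS](_ : _ = (2 * (diam_const * s))%:E); last by congr _%:E; ring.
  move: cI; rewrite inE/= in_itv/= => /andP[c0 c3].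
  have mE'c : measurable (ysection E' c) by exact: measurable_ysection.
  have K0 : 0 <= diam_const * s by exact: mulr_ge0 diam_const_ge0 s0.
  apply: (@lebesgue_diam R (diam_const * s) (ysection E' c) mE'c K0) => {K0 mE'c}.
  move=> r r'; rewrite /ysection/= !inE /E' /polar /E /overlap /box/=.
  rewrite !(distrC (code _ _ (true :: w))) !(mulrC _ c).
  move=> [[rI crI] H] [[rI' crI'] H'].
  case/andP: rI rI' => r0 r1 /andP[r'0 r'1].
  case/andP: crI crI' => _ cr /andP[_ cr'].
  have l1p : 0 <= l1 by lra.
  exact: (code_diff_diam c0 wn w'n (le_trans l1p r0) r1 cr
    (le_trans l1p r'0) r'1 cr' H H').
rewrite -[leLHS]/(leb (ysection E' c)).
suff -> : ysection E' c = set0 by rewrite measure0.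
apply/seteqP; split=> // r; rewrite /ysection/= inE /E' /polar /E /overlap /box/=.
move=> [[rI crI] _]; move: cI; rewrite notin_setE/= in_itv/=; apply.
apply/andP; split; nra.
Qed.

(** Half of the words w' start with another letter than w and are controlled by
    [lebesgue2_overlap_le]. For the other half the common first letter scales
    the difference of the codes by at least l1 or l2, so the tails have codes
    within s / l1 or s / l2, and the bound follows by induction. *)
Lemma sum_overlap_le l1 l2 n w (s : R) :
  1 / 4 <= l1 -> 1 / 4 <= l2 -> w \in words n -> 0 <= s ->
  (\sum_(w' <- words n) lebesgue2 R (overlap l1 l2 w w' s) <=
   (1 + 2 ^+ n * (3 * (diam_const * s) * weight (2 * l1)^-1 (2 * l2)^-1 w))%:E)%E.
Proof.
move=> l10 l20; elim: n w s => [|n IH] w s.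
  rewrite inE => /eqP -> s0; rewrite big_seq1 /= !mulr0 addr0.
  apply: (@le_trans _ _ (lebesgue2 R (`[0%R, 1%R] `*` `[0%R, 1%R]))).
    apply: le_measure; rewrite ?inE.
    - exact: measurable_overlap.
    - by apply: measurableX; exact: measurable_itv.
    - by move=> b [[/= b1 b2] _]; split; rewrite /= in_itv/=; lra.
  rewrite product_measure1E; [|exact: measurable_itv..].
  rewrite -[leLHS]/(leb `[0%R, 1%R]%classic * leb `[0%R, 1%R]%classic)%E.
  by rewrite lebesgue_measure_itv/= lte_fin ltr01 oppr0 adde0 mule1.
move=> wn s0; have := size_words wn; move: wn.
case: w => // t w; rewrite /= mem_cat => wn [sw].
have {}wn : w \in words n.
  by case/orP: wn => /mapP[v vn [_ ->]].
have lt0 : 0 < (if t then l1 else l2) by case: ifP => _; lra.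
have same (w' : seq bool) : (lebesgue2 R (overlap l1 l2 (t :: w) (t :: w') s) <=
    lebesgue2 R (overlap l1 l2 w w' (s / (if t then l1 else l2))))%E.
  apply: le_measure; rewrite ?inE; [exact: measurable_overlap..|].
  move=> b [/= [b1 b2] H]; split => //=; rewrite ler_pdivlMr//.
  apply: le_trans H.
  have -> : (if t then b.1 * code b.1 b.2 w else 1 + b.2 * code b.1 b.2 w) -
     (if t then b.1 * code b.1 b.2 w' else 1 + b.2 * code b.1 b.2 w') =
     (code b.1 b.2 w - code b.1 b.2 w') * (if t then b.1 else b.2).
    by case: t {wn lt0}; ring.
  rewrite normrM ler_wpM2l// (le_trans _ (ler_norm _))//.
  by case: t {wn lt0}; lra.
have differ (w' : seq bool) : w' \in words n ->
    (lebesgue2 R (overlap l1 l2 (t :: w) (~~ t :: w') s) <= (6 * (diam_const * s))%:E)%E.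
  move=> /size_words w'n; case: t {wn lt0 same} => /=.
    exact: (@lebesgue2_overlap_le l1 l2 n w w').
  have -> : overlap l1 l2 (false :: w) (true :: w') s = overlap l1 l2 (true :: w') (false :: w) s.
    by rewrite /overlap; congr (_ `&` _); apply/seteqP; split=> b /=; rewrite distrC.
  exact: (@lebesgue2_overlap_le l1 l2 n w' w).
have sum_same : (\sum_(w' <- words n) lebesgue2 R (overlap l1 l2 (t :: w) (t :: w') s)
   <= (1 + 2 ^+ n * (3 * (diam_const * (s / (if t then l1 else l2))) *
        weight (2 * l1)^-1 (2 * l2)^-1 w))%:E)%E.
  apply: le_trans (IH w _ wn _); last by rewrite divr_ge0// ltW.
  by apply: lee_sum => w' _; exact: same.
have sum_differ : (\sum_(w' <- words n) lebesgue2 R (overlap l1 l2 (t :: w) (~~ t :: w') s)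
   <= (2 ^+ n * (6 * (diam_const * s)))%:E)%E.
  rewrite -sum_words_cst.
  rewrite -sumEFin big_seq_cond [leRHS]big_seq_cond.
  by apply: lee_sum => w' /andP[w'n _]; exact: differ.
rewrite big_cat !big_map/=.
have {sum_same sum_differ} := leeD sum_same sum_differ.
rewrite -EFinD; set B := (X in (_ <= X%:E)%E -> _) => H.
have HB : (B%:E <= (1 + 2 ^+ n.+1 * (3 * (diam_const * s) *
    (1 + (if t then (2 * l1)^-1 else (2 * l2)^-1) * weight (2 * l1)^-1 (2 * l2)^-1 w)))%:E)%E.
  rewrite lee_fin le_eqVlt; apply/orP; left; apply/eqP; rewrite /B exprS.
  clear -l10 l20; have l1n : l1 != 0 by rewrite gt_eqF//; lra.
  have l2n : l2 != 0 by rewrite gt_eqF//; lra.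
  by move: (diam_const : R) => K; case: t; field.
apply: le_trans HB; apply: le_trans H; clear.
by case: t; [exact: lexx|rewrite addeC; exact: lexx].
Qed.

End overlap.

(** * Collisions at a given scale *)

Section energy.
Context {R : realType}.
Implicit Types (w : seq bool).

(** By Fatou's lemma the lower limit of f has a finite integral, so it is
    finite almost everywhere. *)
Lemma ae_recurrent_bound d (T : measurableType d) (mu : measure T R)
    (f : nat -> T -> \bar R) (C : R) :
  (forall n, measurable_fun setT (f n)) -> (forall n x, 0 <= f n x)%E ->
  (forall n, \int[mu]_x f n x <= C%:E)%E ->
  {ae mu, forall x, exists L : R, forall n0, exists2 n,
    (n0 <= n)%N & (f n x <= L%:E)%E}.
Proof.
move=> mf f0 fC.
pose g x := limn_einf (f ^~ x).
have einf_ge0 x n : (0 <= einfs (f ^~ x) n)%E.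
  by apply: le_ereal_inf_tmp => _ [k _ <-].
have einf_le_g x n : (einfs (f ^~ x) n <= g x)%E.
  rewrite /g limn_einf_lim (cvg_lim _ (@cvg_einfs_sup _ _))//.
  by apply: ereal_sup_ubound; exists n.
have g0 x : (0 <= g x)%E by apply: le_trans (einf_le_g x 0%N); exact: einf_ge0.
have mg : measurable_fun setT g.
  apply: measurableT_comp => //; apply: measurable_fun_limn_esup => n.
  by apply: measurableT_comp => //; exact: mf.
have intg : (\int[mu]_x g x <= C%:E)%E.
  apply: le_trans (fatou mu measurableT mf (fun n x _ => f0 n x)) _.
  rewrite limn_einf_lim; apply: lime_le; first exact: is_cvg_einfs.
  apply: nearW => n; apply: le_trans (fC n).
  by apply: ereal_inf_lbound; exists n => //=.
have ig : mu.-integrable setT g.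
  apply/integrableP; split => //; apply: (@le_lt_trans _ _ C%:E); last by rewrite ltry.
  by under eq_integral do rewrite gee0_abs//.
apply: filterS (integrable_ae measurableT ig) => x /(_ I) gfin.
exists (fine (g x) + 1) => n0.
have : (einfs (f ^~ x) n0 < (fine (g x) + 1)%:E)%E.
  apply: le_lt_trans (einf_le_g x n0) _.
  by rewrite EFinD fineK// -[ltLHS]adde0 lteD2lE// lte_fin.
by move=> /ereal_inf_lt[_ [n /= n0n <-] /ltW]; exists n.
Qed.

(** Codes of sequences that agree up to index n differ by at most this
    ([limit_code_near]), so n letters determine the code at this scale. *)
Definition mesh n : R := 3 * (649 / 1000) ^+ n.

(** The probability that two independent words of length n, of which the first
    has weight at most M, have codes within 4 [mesh n], divided by
    [mesh n]. *)
Definition energy (l1 l2 y1 y2 M : R) n (b : plane R) : R :=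
  (mesh n)^-1 * (4 ^+ n)^-1 *
  \sum_(w <- words n | weight y1 y2 w <= M) \sum_(w' <- words n)
    \1_(overlap l1 l2 w w' (4 * mesh n)) b.

Lemma mesh_gt0 n : 0 < mesh n.
Proof. by apply: mulr_gt0; [|apply: exprn_gt0]; lra. Qed.

Lemma mesh_ge n : (2 ^+ n)^-1 <= mesh n.
Proof.
rewrite /mesh -exprVn; apply: (@le_trans _ _ ((649/1000) ^+ n)).
  by apply: lerXn2r; rewrite ?nnegrE; lra.
by apply: ler_peMl; [apply: exprn_ge0|]; lra.
Qed.

(** The summand 1 bounds the contribution of pairs of equal words, whose
    probability 2^-n is at most [mesh n]. *)
Lemma integral_energy_le (l1 l2 y1 y2 M : R) m n :
  1 / 4 <= l1 -> 1 / 4 <= l2 -> 0 <= y1 -> 0 <= y2 ->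
  (2 * l1)^-1 = y1 ^+ m.+1 -> (2 * l2)^-1 = y2 ^+ m.+1 -> 0 <= M ->
  (\int[lebesgue2 R]_b (energy l1 l2 y1 y2 M n b)%:E <=
    (1 + 3 * (diam_const * 4) * M ^+ m.+1)%:E)%E.
Proof.
move=> l10 l20 y10 y20 E1 E2 M0.
set mu := lebesgue2 R.
pose f w w' (b : plane R) := ((\1_(overlap l1 l2 w w' (4 * mesh n)) b : R)%:E).
have mf w w' : measurable_fun setT (f w w').
  by apply/measurable_EFinP/measurable_indic; exact: measurable_overlap.
have f0 w w' b : (0 <= f w w' b)%E by rewrite lee_fin.
pose ws := [seq w <- words n | weight y1 y2 w <= M].
pose c := (mesh n)^-1 * (4 ^+ n)^-1.
have c0 : 0 <= c by rewrite mulr_ge0// invr_ge0 ?exprn_ge0// ltW// mesh_gt0.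
have -> : (fun b => (energy l1 l2 y1 y2 M n b)%:E) =
    (fun b => c%:E * \sum_(w <- ws) \sum_(w' <- words n) f w w' b)%E.
  apply/funext => b; rewrite /energy EFinM -/c; congr (_ * _)%E.
  rewrite -sumEFin big_filter; apply: eq_bigr => w _.
  by rewrite -sumEFin.
rewrite ge0_integralZl_EFin//; last 2 first.
- by move=> b _; apply: sume_ge0 => w _; apply: sume_ge0.
- by apply: emeasurable_sum => w; apply: emeasurable_sum.
rewrite ge0_integral_sum//; last 2 first.
- by move=> w; apply: emeasurable_sum.
- by move=> w b _; apply: sume_ge0.
pose B : R := 1 + 2 ^+ n * (3 * (diam_const * (4 * mesh n)) * M ^+ m.+1).
have inner w : w \in words n -> weight y1 y2 w <= M ->
    (\int[mu]_b \sum_(w' <- words n) f w w' b <=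
B%:E)%E.
  move=> wn wM; rewrite ge0_integral_sum//.
  have int_close (w' : seq bool) :
      (\int[mu]_b f w w' b = mu (overlap l1 l2 w w' (4 * mesh n)))%E.
    by rewrite integral_indic ?setIT//; exact: measurable_overlap.
  under eq_bigr do rewrite int_close.
  have s0 : 0 <= 4 * mesh n by apply: mulr_ge0; rewrite ?ler0n// ltW// mesh_gt0.
  apply: le_trans (sum_overlap_le l10 l20 wn s0) _.
  rewrite lee_fin lerD2l; apply: ler_wpM2l; first by rewrite exprn_ge0.
  apply: ler_wpM2l.
    by apply: mulr_ge0; [exact: ler0n|exact: mulr_ge0 diam_const_ge0 s0].
  rewrite E1 E2; apply: le_trans (weight_exp m w y10 y20) _.
  by rewrite lerXn2r// nnegrE weight_ge0.
have B0 : 0 <= B.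
  apply: addr_ge0 => //; apply: mulr_ge0; first exact: exprn_ge0.
  apply: mulr_ge0; last exact: exprn_ge0.
  apply: mulr_ge0; first exact: ler0n; apply: mulr_ge0; first exact: diam_const_ge0.
  by rewrite mulr_ge0// ltW// mesh_gt0.
have outer : (\sum_(w <- ws) \int[mu]_b \sum_(w' <- words n) f w w' b <= (2 ^+ n * B)%:E)%E.
  apply: (@le_trans _ _ (\sum_(w <- ws) B%:E)%E).
    rewrite big_seq_cond [leRHS]big_seq_cond; apply: lee_sum => w.
    by rewrite mem_filter => /andP[/andP[wM wn] _]; exact: inner.
  rewrite -sum_words_cst -sumEFin big_filter [leRHS](bigID (fun w => weight y1 y2 w <= M))/=.
  by rewrite leeDl// sume_ge0// => w _; rewrite lee_fin.
apply: (@le_trans _ _ (c%:E * (2 ^+ n * B)%:E)%E).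
  by rewrite lee_wpmul2l// lee_fin.
rewrite -EFinM lee_fin /c /B.
have r0 := mesh_gt0 n; have rn := mesh_ge n.
move: (mesh n) r0 rn => r r0 rn.
have t0 : 0 < 2 ^+ n :> R by rewrite exprn_gt0.
have -> : 4 ^+ n = 2 ^+ n * 2 ^+ n :> R by rewrite -exprMn; congr (_ ^+ _); ring.
have {}rn : (2 ^+ n)^-1 / r <= 1 by rewrite ler_pdivrMr// mul1r.
move: (2 ^+ n : R) (diam_const : R) (M ^+ m.+1) t0 rn => t K N t0 rn.
have -> : r^-1 / (t * t) * (t * (1 + t * (3 * (K * (4 * r)) * N))) =
  t^-1 / r + 3 * (K * 4) * N.
  by field; rewrite !gt_eqF.
by rewrite lerD2r.
Qed.

Lemma ae_energy_bound (l1 l2 y1 y2 : R) m :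
  1 / 4 <= l1 -> 1 / 4 <= l2 -> 0 <= y1 -> 0 <= y2 ->
  (2 * l1)^-1 = y1 ^+ m.+1 -> (2 * l2)^-1 = y2 ^+ m.+1 ->
  {ae lebesgue2 R, forall b, forall M : nat, exists L : R, forall n0,
    exists2 n, (n0 <= n)%N & energy l1 l2 y1 y2 M%:R n b <= L}.
Proof.
move=> l10 l20 y10 y20 E1 E2; apply: ae_foralln => M.
have H := @ae_recurrent_bound _ _ (lebesgue2 R)
  (fun n b => (energy l1 l2 y1 y2 M%:R n b)%:E) (1 + 3 * (diam_const * 4) * M%:R ^+ m.+1).
apply: filterS (H _ _ _) => [b [L HL]| |n b|n].
- by exists L => n0; have [n n0n] := HL n0; rewrite lee_fin; exists n.
- move=> n; apply/measurable_EFinP; apply: measurable_funM => //.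
  rewrite (_ : (fun b => _) = (fun b => \sum_(w <- [seq w <- words n | weight y1 y2 w <= M%:R])
     \sum_(w' <- words n) \1_(overlap l1 l2 w w' (4 * mesh n)) b)).
    apply: measurable_sum => w; apply: measurable_sum => w'.
    by apply: measurable_indic; exact: measurable_overlap.
  by apply/funext => b; rewrite big_filter.
- rewrite lee_fin /energy mulr_ge0//; last first.
    by apply: sumr_ge0 => w _; apply: sumr_ge0.
  by rewrite mulr_ge0// invr_ge0 ?exprn_ge0// ltW// mesh_gt0.
- exact: integral_energy_le.
Qed.

End energy.

(** * Coin tosses as digits of a uniform point *)

Section coin.
Context {R : realType}.
Local Notation leb := (@lebesgue_measure R).

(** Half open, so that each of the two inverse branches of [dbl] yields points
    with a definite sign. *)
Definition unit_itv : set (measurableTypeR R) := `[-1, 1[%classic.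

Lemma measurable_unit_itv : measurable unit_itv.
Proof. exact: measurable_itv. Qed.

Definition coin : set (measurableTypeR R) -> \bar R :=
  mscale (2^-1)%:nng (mrestr leb measurable_unit_itv).

HB.instance Definition _ := Measure.on coin.

Lemma coinE A : coin A = ((2^-1)%:E * leb (A `&` unit_itv))%E.
Proof. by []. Qed.

Lemma coin_setT : coin setT = 1%E.
Proof.
rewrite coinE setTI lebesgue_measure_itv/= lte_fin.
have -> : (-1 < 1 :> R) by lra.
by rewrite -EFinD -EFinM; congr _%:E; field.
Qed.

HB.instance Definition _ := @Measure_isProbability.Build _ _ R coin coin_setT.

Lemma coin_eq (A B : set (measurableTypeR R)) :
  (forall u, -1 <= u < 1 -> A u <-> B u) -> coin A = coin B.
Proof.
move=> AB; rewrite !coinE; congr (_ * leb _)%E; apply/seteqP; split=> u [];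
by rewrite /unit_itv/= in_itv/= => + uI; have := AB u uI; tauto.
Qed.

Lemma coin_dominated (A : set (measurableTypeR R)) :
  measurable A -> leb A = 0%E -> coin A = 0%E.
Proof.
move=> mA A0; rewrite coinE (_ : leb _ = 0%E) ?mule0//.
by apply/eqP; rewrite -measure_le0 -A0 measureIl//; exact: measurable_unit_itv.
Qed.

Definition branch1 (u : R) : R := (u + 1) / 2.
Definition branch2 (u : R) : R := (u - 1) / 2.

(** The self-similarity of the uniform distribution: each branch maps [-1, 1[
    onto one half of it with ratio 1/2. *)
Lemma coin_split (A : set (measurableTypeR R)) : measurable A ->
  coin A = ((2^-1)%:E * coin (branch1 @^-1` A) +
            (2^-1)%:E * coin (branch2 @^-1` A))%E.
Proof.
move=> mA.
pose J (c : R) : set (measurableTypeR R) := `[c - 2^-1 - 2^-1, c - 2^-1 + 2^-1[%classic.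
have mJ c : measurable (J c) by exact: measurable_itv.
have half (c l : R) : c = 2^-1 * l + 2^-1 ->
   leb ((fun u => (u + l) / 2) @^-1` A `&` unit_itv) =
   (2%:E * leb (A `&` J c))%E.
  move=> cE.
  rewrite (_ : _ `&` _ = (fun u => 2^-1 * u + 2^-1 * l) @^-1` (A `&` J c)).
    rewrite lebesgue_affine ?invrK ?invr_gt0//.
    exact: (measurableI _ _ mA (mJ c)).
  apply/seteqP; split=> u /=; rewrite /unit_itv /J/= !in_itv/= cE => -[H1 H2];
  have e : (u + l) / 2 = 2^-1 * u + 2^-1 * l by field.
    by rewrite -e; split => //; lra.
  by rewrite e; split => //; lra.
rewrite !coinE (half 1 1); last by field.
rewrite (half 0 (-1)); last by field.
rewrite !muleA -!EFinM -mulrA mulVf// mulr1 -ge0_muleDr//.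
congr (_ * _)%E.
have J1 : (J 1 : set R) = `[0, 1[%classic.
  by rewrite /J subrK (_ : 1 - 2^-1 - 2^-1 = 0)//; field.
have J0 : (J 0 : set R) = `[-1, 0[%classic.
  by rewrite /J subrK (_ : 0 - 2^-1 - 2^-1 = -1)//; field.
rewrite -measureU/=; [|exact: measurableI..|].
  rewrite -setIUr setUC J0 J1; congr (leb (_ `&` _)).
  by rewrite -(@itv_bndbnd_setU _ _ (BLeft (-1)) (BLeft 0) (BLeft 1))// bnd_simp; lra.
rewrite setIACA J0 J1; apply/seteqP; split=> //.
move=> v [_ []]; rewrite /= !in_itv/= => /andP[v0 _] /andP[_].
by rewrite ltNge v0.
Qed.

Definition dbl (y : R) : R := if 0 <= y then 2 * y - 1 else 2 * y + 1.

Lemma dbl_branch1 u : -1 <= u -> 0 <= branch1 u /\ dbl (branch1 u) = u.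
Proof.
move=> u1; have h : 0 <= branch1 u by rewrite /branch1; lra.
by split=> //; rewrite /dbl h /branch1 /branch2; field.
Qed.

Lemma dbl_branch2 u : u < 1 -> (0 <= branch2 u) = false /\ dbl (branch2 u) = u.
Proof.
move=> u1; have h : (0 <= branch2 u) = false by apply/negbTE; rewrite -ltNge /branch2; lra.
by split=> //; rewrite /dbl h /branch1 /branch2; field.
Qed.

Lemma measurable_halfline : measurable ([set y | 0 <= y] : set (measurableTypeR R)).
Proof.
rewrite (_ : [set y | _] = `[0, +oo[%classic); first exact: measurable_itv.
by apply/seteqP; split=> y /=; rewrite in_itv/= andbT.
Qed.

Lemma measurable_dbl : measurable_fun setT (dbl : measurableTypeR R -> measurableTypeR R).
Proof.
apply: measurable_fun_ifT => /=.
- apply: (measurable_fun_bool true); rewrite setTI.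
  exact: measurable_halfline.
- by apply: measurable_funB => //; exact: measurable_funM.
- by apply: measurable_funD => //; exact: measurable_funM.
Qed.

Fixpoint word n (u : R) : seq bool :=
  if n is n'.+1 then (0 <= u) :: word n' (dbl u) else [::].

Lemma measurable_word n (Q : pred (seq bool)) :
  measurable ([set u | Q (word n u)] : set (measurableTypeR R)).
Proof.
elim: n Q => [|n IH] Q /=.
  by case: (Q [::]); [rewrite (_ : [set _ | _] = setT)|rewrite (_ : [set _ | _] = set0)];
    by [|apply/seteqP; split].
rewrite (_ : [set u | _] =
   ([set y | 0 <= y] `&` dbl @^-1` [set u | Q (true :: word n u)]) `|`
   (~` [set y | 0 <= y] `&` dbl @^-1` [set u | Q (false :: word n u)])).
  have mpre (B : set (measurableTypeR R)) : measurable B -> measurable (dbl @^-1` B).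
    by move=> mB; rewrite -[_ @^-1` _]setTI; exact: measurable_dbl.
  apply: measurableU; apply: measurableI.
  - exact: measurable_halfline.
  - by apply: mpre; exact: (IH (fun w => Q (true :: w))).
  - by apply: measurableC; exact: measurable_halfline.
  - by apply: mpre; exact: (IH (fun w => Q (false :: w))).
apply/seteqP; split=> u /=.
  by case: (boolP (0 <= u)) => h Qu; [left|right]; split => //; exact/negP.
by case=> [] [+ Qu] => [->//|/negP/negbTE ->].
Qed.

Lemma coin_word n (Q : pred (seq bool)) :
  coin [set u | Q (word n u)] =
  ((2 ^+ n)^-1 * \sum_(w <- words n) (Q w)%:R)%:E.
Proof.
elim: n Q => [|n IH] Q.
  rewrite big_seq1 expr0 invr1 mul1r; case: (boolP (Q [::])) => h.
    rewrite (_ : [set _ | _] = setT) ?coin_setT//.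
    by apply/seteqP; split.
  rewrite (_ : [set _ | _] = set0) ?measure0//.
  by apply/seteqP; split => u //=; rewrite (negbTE h).
rewrite coin_split; last exact: measurable_word.
rewrite (coin_eq (B := [set u | Q (true :: word n u)])); last first.
  by move=> u /andP[u1 _] /=; have [-> ->] := dbl_branch1 u1.
rewrite [in X in (_ + X)%E](coin_eq (B := [set u | Q (false :: word n u)])); last first.
  by move=> u /andP[_ u1] /=; have [-> ->] := dbl_branch2 u1.
rewrite (IH (fun w => Q (true :: w))) (IH (fun w => Q (false :: w))).
rewrite -!EFinM -EFinD big_words; congr _%:E.
rewrite exprS invfM; ring.
Qed.

End coin.

(** * A criterion for absolute continuity *)

Section criterion.
Context {R : realType}.
Local Notation leb := (@lebesgue_measure R).
Context d (T : measurableType d) (P : probability T R) (x : T -> R).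
Hypothesis mx : measurable_fun setT x.

Let mpre (A : set R) : measurable A -> measurable (x @^-1` A).
Proof. by move=> mA; rewrite -[_ @^-1` _]setTI; exact: mx. Qed.

(** Cut the interval into cells of length rho. If a cell contains the image of
    some u outside B, its mass is at most the mass within rho of x u. *)
Lemma thick_interval_le (K rho : R) (B : set T) :
  0 < rho -> 0 <= K -> measurable B ->
  (forall u, ~ B u -> (P [set v | (`|x v - x u| <= rho)%R] <= (K * rho)%:E)%E) ->
  forall a b, a <= b ->
  (P (x @^-1` `]a, b]%classic `\` B) <= (K * (b - a + rho))%:E)%E.
Proof.
move=> rho0 K0 mB HB.
pose S (a b : R) : set T := x @^-1` `]a, b]%classic `\` B.
have mcell (a b : R) : measurable (S a b).
  by apply: measurableD => //; apply: mpre; exact: measurable_itv.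
have cell a : (P (S a (a + rho)%R) <= (K * rho)%:E)%E.
  have [->|/set0P[u [/= ua Bu]]] := eqVneq (S a (a + rho)%R) set0.
    by rewrite measure0 lee_fin mulr_ge0// ltW.
  apply: le_trans (HB _ Bu); apply: le_measure; rewrite ?inE.
  - exact: mcell.
  - have -> : [set v | `|x v - x u| <= rho] = x @^-1` `[x u - rho, x u + rho].
      apply/seteqP; split=> v /=; rewrite in_itv/= ler_norml; lra.
    by apply: mpre; exact: measurable_itv.
  - by move=> v [/= va _]; move: ua va; rewrite !in_itv/= ler_norml; lra.
have cells m a : (P (S a (a + m%:R * rho)%R) <= (m%:R * (K * rho))%:E)%E.
  elim: m => [|m IH].
    by rewrite /S mul0r addr0 set_itvoc0 preimage_set0 set0D measure0 mul0r.
  apply: (@le_trans _ _ (P (S a (a + m%:R * rho)%R `|`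
     S (a + m%:R * rho)%R (a + m%:R * rho + rho)%R))%E).
    apply: le_measure; rewrite ?inE; [exact: mcell|by apply: measurableU|].
    move=> v [/= va vB]; move: va; rewrite !in_itv/= -natr1 mulrDl mul1r => va.
    have [h|h] := leP (x v) (a + m%:R * rho); [left|right]; split => //;
      by rewrite /= in_itv/=; lra.
  apply: (le_trans (measureU2 _ (mcell _ _) (mcell _ _))).
  rewrite -natr1 mulrDl mul1r EFinD; apply: leeD => //; exact: cell.
move=> a b ab.
pose m := (Num.truncn ((b - a) / rho)).+1.
have q0 : 0 <= (b - a) / rho by rewrite divr_ge0 ?subr_ge0// ltW.
have m1 : b - a <= m%:R * rho.
  by rewrite -ler_pdivrMr// ltW// truncnS_gt.
have m2 : m%:R * rho <= b - a + rho.
  by rewrite -natr1 mulrDl mul1r lerD2r -ler_pdivlMr// truncn_le.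
apply: (@le_trans _ _ (P (S a (a + m%:R * rho)%R))).
  apply: le_measure; rewrite ?inE; [exact: mcell..|].
  by move=> v [/= va vB]; split => //; move: va; rewrite /= !in_itv/=; lra.
apply: le_trans (cells m a) _.
by rewrite lee_fin mulrCA ler_wpM2l.
Qed.

(** Cover N by intervals of small total length. Finitely many of them carry
    nearly all of the mass of their union, and for rho small compared with
    the inverse of their number the mass is at most P B plus K times the total
    length plus a small error. *)
Lemma null_preimage_of_thin :
  (forall e : R, 0 < e -> exists2 K : R, 0 <= K & forall r0, 0 < r0 ->
    exists rho B, [/\ 0 < rho < r0, measurable B, (P B <= e%:E)%E &
      forall u, ~ B u -> (P [set v | (`|x v - x u| <= rho)%R] <= (K * rho)%:E)%E]) ->
  forall N : set R, measurable N -> leb N = 0%E -> P (x @^-1` N) = 0%E.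
Proof.
move=> code_law_ac N mN N0; apply/eqP; rewrite -measure_le0.
apply/lee_addgt0Pr => e3 e30; rewrite add0e.
have [e e0 ->] : exists2 e, 0 < e & e3 = e + e + e.
  by exists (e3 / 3); [rewrite divr_gt0|field].
have [K K0 HK] := code_law_ac _ e0.
have K1 : 0 < K + 1 by rewrite ltr_wpDl.
have dK0 : 0 < e / (K + 1) by rewrite divr_gt0.
have /ereal_inf_lt[_ [/= F covF <-] FE] : (leb N < (e / (K + 1))%:E)%E.
  by rewrite N0 lte_fin.
have mF k : measurable (F k : set R).
  by case: covF => /(_ k) + _ => -[[a b] _ <-]; exact: measurable_itv.
apply: (@le_trans _ _ (P (\bigcup_k x @^-1` F k))).
  apply: le_measure; rewrite ?inE; [exact: mpre| |].
    by apply: bigcup_measurable => k _; exact: mpre.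
  by move=> v Nv; case: covF => _ /(_ _ Nv).
rewrite -bigcup_bigsetU_bigcup.
have mU n : measurable (\big[setU/set0]_(k < n) x @^-1` F k).
  by apply: bigsetU_measurable => k _; exact: mpre.
pose U n : set T := \big[setU/set0]_(k < n.+1) x @^-1` F k.
have homoU : {homo U : m n / (m <= n)%N >-> (m <= n)%O}.
  move=> m n mn; apply/subsetPset.
  exact: (@subset_bigsetU _ (fun k => x @^-1` F k) m.+1 n.+1 mn).
have mcup : measurable (\bigcup_n U n).
  by apply: bigcup_measurable => n _; exact: mU.
have cU := nondecreasing_cvg_mu (mu := P) (fun n => mU n.+1) mcup homoU.
rewrite -(cvg_lim _ cU)//; apply: lime_le; first by apply/cvg_ex; eexists; exact: cU.
apply: nearW => n'; set n := n'.+1 => /=.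
have [rho [B [/andP[rho0 rhoe] mB PB HB]]] := HK (e / (K + 1) / n%:R) (divr_gt0 dK0 (ltr0Sn _ _)).
have length k : (0 <= wlength idfun (F k))%E.
  exact: wlength_ge0.
have thick k : (P (x @^-1` F k `\` B) <= K%:E * (wlength idfun (F k) + rho%:E))%E.
  have := length k; case: covF => /(_ k) + _ => -[[a b] _ <-] /=.
  rewrite wlength_itv/= lte_fin; case: ifP => ab l0.
    rewrite -EFinB -EFinD -EFinM; apply: (thick_interval_le rho0 K0 mB HB); exact: ltW.
  rewrite set_itv_ge ?preimage_set0 ?set0D ?measure0; last by rewrite bnd_simp ab.
  by rewrite add0e -EFinM lee_fin mulr_ge0// ltW.
apply: (@le_trans _ _ (P (B `|` \big[setU/set0]_(k < n) (x @^-1` F k `\` B)))).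
  apply: le_measure; rewrite ?inE; first exact: mU.
    apply: measurableU => //; apply: bigsetU_measurable => k _.
    by apply: measurableD => //; exact: mpre.
  rewrite -(bigcup_mkord n (fun k => x @^-1` F k)) -(bigcup_mkord n (fun k => x @^-1` F k `\` B)).
  move=> v [k kn Fv].
  by have [Bv|Bv] := pselect (B v); [left|right; exists k].
have mD k : measurable (x @^-1` F k `\` B) by apply: measurableD => //; exact: mpre.
pose D k : set T := x @^-1` F k `\` B.
have mDU : measurable (\big[setU/set0]_(k < n) D k).
  by apply: bigsetU_measurable => k _; exact: mD.
apply: (@le_trans _ _ (P B + P (\big[setU/set0]_(k < n) D k))%E).
  exact: measureU2.
rewrite -addrA EFinD; apply: leeD => //.
apply: (@le_trans _ _ (\sum_(k < n) P (D k))%E).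
  by apply: content_subadditive => // k _; exact: mD.
apply: (@le_trans _ _ (\sum_(k < n) K%:E * (wlength idfun (F k) + rho%:E))%E).
  by apply: lee_sum => k _; exact: thick.
rewrite -ge0_sume_distrr; last by move=> k _; rewrite adde_ge0// lee_fin ltW.
rewrite big_split/= sumEFin sumr_const card_ord -mulr_natl.
have sl : (\sum_(k < n) wlength idfun (F k) <= (e / (K + 1))%:E)%E.
  apply: le_trans (ltW FE).
  rewrite -(big_mkord xpredT (fun k => wlength idfun (F k))).
  by apply: nneseries_lim_ge => k _ _; exact: length.
have sr : n%:R * rho <= e / (K + 1).
  by rewrite mulrC -ler_pdivlMr// ltW.
apply: (@le_trans _ _ (K%:E * ((e / (K + 1))%:E + (e / (K + 1))%:E))%E).
  by apply: lee_wpmul2l; [rewrite lee_fin|apply: leeD => //; rewrite lee_fin].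
have Kq : K * (e / (K + 1)) <= e.
  by rewrite mulrCA ler_piMr ?ltW// ltr_pdivrMr// mul1r ltrDl.
by rewrite -EFinD -EFinM lee_fin mulrDr lerD.
Qed.

End criterion.

(** * Codes of infinite sequences *)

Section limit_code.
Context {R : realType}.
Local Notation leb := (@lebesgue_measure R).
Variables b1 b2 : R.
Hypotheses (b1I : 0 < b1 <= 649 / 1000) (b2I : 0 < b2 <= 649 / 1000).

Let b10 : 0 <= b1. Proof. by case/andP: b1I => /ltW. Qed.
Let b20 : 0 <= b2. Proof. by case/andP: b2I => /ltW. Qed.
Let b1x : b1 <= 649 / 1000. Proof. by case/andP: b1I. Qed.
Let b2x : b2 <= 649 / 1000. Proof. by case/andP: b2I. Qed.
Let b1x1 : b1 <= 1. Proof. by move: b1x; lra. Qed.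

Lemma code_ge0 w : 0 <= code b1 b2 w.
Proof.
elim: w => //= s w IH; case: s; first exact: mulr_ge0.
by rewrite addr_ge0// mulr_ge0.
Qed.

(** The point 1 - 2 (1 - b2) code w remains in [-1, 1]. *)
Lemma code_le w : (1 - b2) * code b1 b2 w <= 1.
Proof.
have c2 : 0 <= 1 - b2 by move: b2x; lra.
elim: w => [|[] w IH] /=; first by rewrite mulr0.
  by rewrite mulrCA mulr_ile1// mulr_ge0// code_ge0.
by have := ler_wpM2l b20 IH; lra.
Qed.

Lemma code_le3 w : code b1 b2 w <= 3.
Proof.
have := code_le w; have := code_ge0 w => c0 c1.
have : (1 - 649/1000) * code b1 b2 w <= (1 - b2) * code b1 b2 w.
  by rewrite ler_wpM2r// lerD2l lerN2.
by move: c1; lra.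
Qed.

(** The first n letters scale the increment by at most (649/1000)^n, and codes
    lie in [0, 3]. *)
Lemma code_word_mono n k (u : R) :
  0 <= code b1 b2 (word (n + k) u) - code b1 b2 (word n u) <=
  3 * (649 / 1000) ^+ n.
Proof.
elim: n u => [|n IH] u.
  by rewrite expr0 mulr1 subr0 code_ge0 code_le3.
rewrite addSn /=; have /andP[h0 h1] := IH (dbl u).
have step c : 0 <= c -> c <= 649/1000 ->
    0 <= c * (code b1 b2 (word (n + k) (dbl u)) - code b1 b2 (word n (dbl u)))
    <= 3 * (649 / 1000) ^+ n.+1.
  by move=> c0 cx; rewrite mulr_ge0//= exprS mulrCA; apply: ler_pM.
case: ifP => _; last rewrite opprD addrACA subrr add0r.
  by rewrite -mulrBr; exact: step.
by rewrite -mulrBr; exact: step.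
Qed.

Definition limit_code (u : R) : R := limn (fun n => code b1 b2 (word n u)).

Lemma cvg_code u : (fun n => code b1 b2 (word n u)) @ \oo --> limit_code u.
Proof.
apply: nondecreasing_is_cvgn.
  move=> m n mn; have := code_word_mono m (n - m) u.
  by rewrite subnKC// => /andP[+ _]; rewrite subr_ge0.
by exists 3 => _ [n _ <-]; exact: code_le3.
Qed.

Lemma limit_code_near n u :
  `|limit_code u - code b1 b2 (word n u)| <= mesh n.
Proof.
have c := @cvg_code u.
have ge : code b1 b2 (word n u) <= limit_code u.
  apply: limr_ge; first by apply/cvg_ex; eexists; exact: c.
  near=> m.
  have nm : (n <= m)%N by near: m; exact: nbhs_infty_ge.
  have := code_word_mono n (m - n) u.
  by rewrite subnKC// => /andP[+ _]; rewrite subr_ge0.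
have s0 : 0 < mesh n :> R := mesh_gt0 n.
rewrite ler_norml; apply/andP; split; first by move: ge s0; lra.
rewrite lerBlDl; apply: limr_le; first by apply/cvg_ex; eexists; exact: c.
near=> m.
have nm : (n <= m)%N by near: m; exact: nbhs_infty_ge.
have := code_word_mono n (m - n) u.
by rewrite subnKC// => /andP[_ +]; rewrite lerBlDl.
Unshelve. all: by end_near. Qed.

Lemma limit_code_step u : limit_code u =
  if 0 <= u then b1 * limit_code (dbl u) else 1 + b2 * limit_code (dbl u).
Proof.
have c : (fun n => code b1 b2 (word n.+1 u)) @ \oo --> limit_code u.
  by rewrite (cvg_shiftS (fun n => code b1 b2 (word n u))); exact: cvg_code.
apply: (cvg_unique _ c) => //=; case: ifP => _.
  by apply: cvgMl_tmp; exact: cvg_code.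
by apply: cvgD; [exact: cvg_cst|apply: cvgMl_tmp; exact: cvg_code].
Qed.

(** The infinite composition of the contractions, whose random law is the
    self-similar measure. *)
Definition coded_point u : R := 1 - 2 * (1 - b2) * limit_code u.

Lemma coded_point_itv u : -1 <= coded_point u <= 1.
Proof.
have c2 : 0 <= 1 - b2 by move: b2x; lra.
have c := @cvg_code u.
have l0 : 0 <= limit_code u.
  apply: limr_ge; first by apply/cvg_ex; eexists; exact: c.
  by apply: nearW => n; exact: code_ge0.
have l1 : (1 - b2) * limit_code u <= 1.
  rewrite mulrC -ler_pdivlMr; last by move: b2x; lra.
  apply: limr_le; first by apply/cvg_ex; eexists; exact: c.
  apply: nearW => n; rewrite ler_pdivlMr; last by move: b2x; lra.
  by rewrite mulrC code_le.
have : 0 <= (1 - b2) * limit_code u by rewrite mulr_ge0.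
rewrite /coded_point -mulrA; lra.
Qed.

Lemma coded_point_step u : coded_point u =
  if 0 <= u then b1 * coded_point (dbl u) + (1 - b1) else b2 * coded_point (dbl u) - (1 - b2).
Proof. by rewrite /coded_point limit_code_step; case: ifP => _; ring. Qed.

Lemma measurable_code_word n :
  measurable_fun setT ((fun u => code b1 b2 (word n u)) : measurableTypeR R -> R).
Proof.
elim: n => [|n IH] /=; first exact: measurable_cst.
have mg : measurable_fun setT
    ((fun u => code b1 b2 (word n (dbl u))) : measurableTypeR R -> R).
  by apply: (measurableT_comp IH); exact: measurable_dbl.
apply: measurable_fun_ifT => /=.
- apply: (measurable_fun_bool true); rewrite setTI; exact: measurable_halfline.
- exact: measurable_funM.
- by apply: measurable_funD => //; exact: measurable_funM.
Qed.

Lemma measurable_coded_point :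
  measurable_fun setT (coded_point : measurableTypeR R -> measurableTypeR R).
Proof.
apply: measurable_funB => //; apply: measurable_funM => //.
apply: (measurable_fun_cvg (h := fun n u => code b1 b2 (word n u))).
  exact: measurable_code_word.
by move=> u _; exact: cvg_code.
Qed.

(** Each code is within [mesh n] of its limit, and the factor
    2 (1 - b2) >= 2 * 351/1000 turns a distance of points [mesh n] into a
    distance of limit codes of at most 2 [mesh n]. *)
Lemma coded_point_dist n u v : `|coded_point v - coded_point u| <= mesh n ->
  `|code b1 b2 (word n u) - code b1 b2 (word n v)| <= 4 * mesh n.
Proof.
have := limit_code_near n u; have := limit_code_near n v.
have -> : coded_point v - coded_point u = 2 * (1 - b2) * (limit_code u - limit_code v).
  by rewrite /coded_point; ring.
have c2 : 0 <= 1 - b2 by move: b2x; lra.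
rewrite normrM ger0_norm; last by rewrite mulr_ge0.
set lu := limit_code u; set lv := limit_code v.
set cu := code _ _ (word n u); set cv := code _ _ (word n v).
move=> hv hu h.
have hl : `|lu - lv| <= 2 * mesh n.
  apply: (@le_trans _ _ (2 * (2 * (1 - b2) * `|lu - lv|))).
    by rewrite mulrA ler_peMl//; move: b2x; lra.
  by rewrite ler_pM2l.
have -> : cu - cv = (lu - lv) - (lu - cu) + (lv - cv) by ring.
apply: (le_trans (ler_normD _ _)).
have := ler_normB (lu - lv) (lu - cu); lra.
Qed.

Lemma mesh_small (r : R) : 0 < r -> exists n0, forall n, (n0 <= n)%N -> mesh n < r.
Proof.
move=> r0.
have c : (fun n => (649/1000 : R) ^+ n) @ \oo --> (0 : R).
  by apply: cvg_expr; rewrite ger0_norm; lra.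
have [n0 _ H] := cvgr0_norm_lt _ c (r / 3) (divr_gt0 r0 (ltr0Sn _ _)).
exists n0 => n n0n; have := H n n0n; rewrite /= ger0_norm; last by apply: exprn_ge0; lra.
by rewrite /mesh ltr_pdivlMr// mulrC.
Qed.

(** At a level n where the energy is at most L, call a word bad if its weight
    exceeds M or if it is close to more than the proportion K [mesh n] of all
    words. By Markov's inequality the bad words have proportion at most
    C / M + L / K, and this can be made small by choosing M, then K. A point u
    with a good word has mass at most K [mesh n] within distance
    [mesh n]. *)
Lemma coded_point_null (l1 l2 y1 y2 : R) :
  l1 <= b1 -> l2 <= b2 -> 0 <= y1 -> 0 <= y2 -> y1 + y2 < 2 ->
  (forall M : nat, exists L : R, forall n0, exists2 n, (n0 <= n)%N &
     energy l1 l2 y1 y2 M%:R n (b1, b2) <= L) ->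
  forall N : set (measurableTypeR R), measurable N -> leb N = 0%E ->
    coin (coded_point @^-1` N) = 0%E.
Proof.
move=> lb1 lb2 y10 y20 y12 HE.
apply: null_preimage_of_thin; first exact: measurable_coded_point.
move=> e e0.
pose C := (1 - (y1 + y2) / 2)^-1.
have C0 : 0 < C by rewrite invr_gt0; lra.
pose M := (Num.truncn (2 * C / e)).+1.
have Me : 2 * C / e < M%:R by exact: truncnS_gt.
have M0 : 0 < M%:R :> R by rewrite ltr0n.
have [L' HL'] := HE M.
pose L := Num.max L' 1.
have L0 : 0 < L by rewrite lt_max ltr01 orbT.
pose K := 2 * L / e.
have K0 : 0 < K by rewrite divr_gt0// mulr_gt0.
exists K; first exact: ltW.
move=> r0 r00; have [n0 Hn0] := mesh_small r00.
have [n n0n En] := HL' n0.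
have {}En : energy l1 l2 y1 y2 M%:R n (b1, b2) <= L by rewrite le_max En.
have rho0 : 0 < mesh n :> R := mesh_gt0 n.
have t0 : 0 < 2 ^+ n :> R by rewrite exprn_gt0.
(* The closeness of codes that [energy] counts, at the parameter (b1, b2). *)
pose hit w w' : bool := `|code b1 b2 w - code b1 b2 w'| <= 4 * mesh n.
pose dens w : R := (2 ^+ n)^-1 * \sum_(w' <- words n) (hit w w')%:R.
have dens0 w : 0 <= dens w by rewrite mulr_ge0 ?invr_ge0 ?(ltW t0)// sumr_ge0.
pose wt := weight y1 y2.
have wt0 w : 0 <= wt w by exact: weight_ge0.
pose Q w := (M%:R < wt w) || (K * mesh n < dens w).
exists (mesh n), [set u | Q (word n u)]; split.
- by rewrite rho0 Hn0.
- exact: measurable_word.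
- rewrite -[leLHS]/(coin [set u | Q (word n u)]) coin_word lee_fin.
  have Qle w : (Q w)%:R <= (M%:R)^-1 * wt w +
      (K * mesh n)^-1 * (if wt w <= M%:R then dens w else 0).
    have Kr0 : 0 < K * mesh n by exact: mulr_gt0 K0 rho0.
    rewrite /Q ltNge; case: (leP (wt w) M%:R) => /= wM.
      have := wt0 w; have := dens0 w => d0 w0.
      case: (ltP (K * mesh n) (dens w)) => dK; rewrite ?mulr1n.
        rewrite ler_wpDl ?mulr_ge0 ?invr_ge0 ?(ltW M0)//.
        by rewrite mulrC ler_pdivlMr// mul1r ltW.
      by rewrite addr_ge0// mulr_ge0// invr_ge0 ltW.
    by rewrite mulr0 addr0 mulrC ler_pdivlMr// mul1r ltW.
  apply: (@le_trans _ _ ((2 ^+ n)^-1 * \sum_(w <- words n) ((M%:R)^-1 * wt w +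
      (K * mesh n)^-1 * (if wt w <= M%:R then dens w else 0)))).
    by rewrite ler_pM2l ?invr_gt0//; apply: ler_sum.
  rewrite big_split/= -!mulr_sumr mulrDr.
  have -> : e = e / 2 + e / 2 by field.
  apply: lerD.
    have S := sum_weight_le n y10 y20 y12.
    apply: (@le_trans _ _ ((2 ^+ n)^-1 * (M%:R^-1 * (2 ^+ n * C)))).
      by rewrite ler_pM2l ?invr_gt0// ler_pM2l ?invr_gt0.
    have -> : (2 ^+ n)^-1 * (M%:R^-1 * (2 ^+ n * C)) = C / M%:R.
      by field; rewrite !gt_eqF.
    rewrite ler_pdivrMr// mulrC -ler_pdivrMr ?divr_gt0// ltW//.
    by apply: le_lt_trans Me; rewrite invf_div mulrCA mulrA.
  rewrite -big_mkcond/=.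
  have EnE : energy l1 l2 y1 y2 M%:R n (b1, b2) =
     (mesh n)^-1 * (2 ^+ n)^-1 * \sum_(w <- words n | wt w <= M%:R) dens w.
    have -> : \sum_(w <- words n | wt w <= M%:R) dens w = (2 ^+ n)^-1 *
        \sum_(w <- words n | wt w <= M%:R) \sum_(w' <- words n) (hit w w')%:R.
      by rewrite mulr_sumr.
    rewrite /energy.
    have -> : 4 ^+ n = 2 ^+ n * 2 ^+ n :> R.
      by rewrite -exprMn; congr (_ ^+ _); ring.
    rewrite [RHS]mulrA; congr (_ * _).
      by rewrite -[RHS]mulrA; congr (_ * _); rewrite invfM.
    apply: eq_bigr => w _; apply: eq_bigr => w' _.
    rewrite indicE; congr (_%:R); congr nat_of_bool; apply/idP/idP => h.
      by move: h; rewrite inE => -[_].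
    by rewrite inE; split => //; rewrite /box/= lb1 lb2.
  have -> : (2 ^+ n)^-1 * ((K * mesh n)^-1 * \sum_(w <- words n | wt w <= M%:R) dens w)
     = K^-1 * energy l1 l2 y1 y2 M%:R n (b1, b2).
    by rewrite EnE; field; rewrite !gt_eqF.
  apply: (@le_trans _ _ (K^-1 * L)); first by rewrite ler_pM2l ?invr_gt0.
  by rewrite /K le_eqVlt; apply/orP; left; apply/eqP; field; rewrite !gt_eqF.
- move=> u /negP; rewrite /Q negb_or -!leNgt => /andP[_ du].
  apply: (@le_trans _ _ (dens (word n u))%:E); last by rewrite lee_fin.
  rewrite -(coin_word n (hit (word n u))).
  apply: le_measure; rewrite ?inE.
  + rewrite (_ : [set v | _] = coded_point @^-1` `[coded_point u - mesh n, coded_point u + mesh n]).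
      by rewrite -[_ @^-1` _]setTI; apply: measurable_coded_point => //; exact: measurable_itv.
    by apply/seteqP; split=> v /=; rewrite in_itv/= ler_norml; lra.
  + exact: measurable_word.
  + by move=> v /coded_point_dist.
Qed.

End limit_code.

(** * Asymptotic independence *)

Section mixing_class.
Context {R : realType} d (T : measurableType d) (P : probability T R).

Definition pr (A : set T) : R := fine (P A).

Lemma prE A : measurable A -> P A = (pr A)%:E.
Proof. by move=> mA; rewrite /pr fineK// fin_num_measure. Qed.

Lemma pr_ge0 A : 0 <= pr A.
Proof. by rewrite /pr fine_ge0. Qed.

Lemma pr_le A B : measurable A -> measurable B -> A `<=` B -> pr A <= pr B.
Proof.
by move=> mA mB AB; rewrite -lee_fin -!prE// le_measure// inE.
Qed.

Lemma pr_le1 A : measurable A -> pr A <= 1.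
Proof. by move=> mA; rewrite -lee_fin -prE// probability_le1. Qed.

Lemma pr_setT : pr setT = 1.
Proof. by rewrite /pr probability_setT. Qed.

Lemma pr_set0 : pr set0 = 0.
Proof. by rewrite /pr measure0. Qed.

Lemma prU A B : measurable A -> measurable B -> A `&` B = set0 ->
  pr (A `|` B) = pr A + pr B.
Proof.
move=> mA mB AB; apply: EFin_inj; rewrite EFinD -!prE//; last exact: measurableU.
exact: measureU.
Qed.

Lemma prIC A B : measurable A -> measurable B -> pr (~` A `&` B) = pr B - pr (A `&` B).
Proof.
move=> mA mB; apply/eqP; rewrite eq_sym subr_eq eq_sym addrC -prU.
- by rewrite -setIUl setUv setTI.
- exact: measurableI.
- by apply: measurableI => //; exact: measurableC.
- by rewrite setIACA setICr set0I.
Qed.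

(** The sets C which are asymptotically independent of Z form a Dynkin class.
    For countable disjoint unions this holds because a tail of the union
    contributes at most its own probability, uniformly in n. *)
Lemma mixing_class (G : set (set T)) (Z : nat -> set T) (p : R) :
  measurable = <<s G >> -> setI_closed G -> 0 <= p <= 1 ->
  (forall n, measurable (Z n)) ->
  pr (Z n) @[n --> \oo] --> p ->
  (forall C, G C -> pr (C `&` Z n) @[n --> \oo] --> p * pr C) ->
  forall C, measurable C -> pr (C `&` Z n) @[n --> \oo] --> p * pr C.
Proof.
move=> GE GI /andP[p0 p1] mZ Zp ZG C mC.
apply: (dynkin_induction (P := [set C | pr (C `&` Z n) @[n --> \oo] --> p * pr C])
  GE GI _ ZG); last by rewrite -GE.
- by rewrite /= pr_setT mulr1; under eq_fun do rewrite setTI.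
- move=> A mA /= HA; under eq_fun do rewrite prIC//.
  have -> : p * pr (~` A) = p - p * pr A.
    by rewrite -[~` A]setIT prIC// setIT pr_setT mulrBr mulr1.
  exact: cvgB.
move=> F mF tF HF /=.
pose FN N := \big[setU/set0]_(k < N) F k.
have mFN N : measurable (FN N) by apply: bigsetU_measurable => k _; exact: mF.
have mU : measurable (\bigcup_k F k) by apply: bigcup_measurable => k _; exact: mF.
have FNU N : FN N `<=` \bigcup_k F k.
  by rewrite /FN -bigcup_mkord => t [k _ Fk]; exists k.
have cFN N : pr (FN N `&` Z n) @[n --> \oo] --> p * pr (FN N).
  elim: N => [|N IH].
    rewrite /FN big_ord0 pr_set0 mulr0; under eq_fun do rewrite set0I pr_set0.
    exact: cvg_cst.
  have dis : FN N `&` F N = set0.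
    rewrite /FN -bigcup_mkord setI_bigcupl bigcup0// => k /= kN.
    by move/trivIsetP : tF; apply => //; rewrite neq_ltn kN.
  rewrite /FN big_ord_recr/= -/(FN N) prU// mulrDr.
  rewrite (_ : (fun n => _) = (fun n => pr (FN N `&` Z n) + pr (F N `&` Z n))).
    by apply: cvgD => //; exact: HF.
  apply/funext => n; rewrite setIUl prU//; [exact: measurableI..|].
  by rewrite setIACA dis set0I.
have cU : pr (FN N) @[N --> \oo] --> pr (\bigcup_k F k).
  rewrite -(cvg_shiftS (fun N => pr (FN N))); apply: fine_cvg; rewrite -prE//.
  rewrite -bigcup_bigsetU_bigcup; apply: nondecreasing_cvg_mu => //.
    by rewrite bigcup_bigsetU_bigcup.
  by move=> m n mn; apply/subsetPset; exact: (@subset_bigsetU _ F m.+1 n.+1 mn).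
apply/cvgrPdist_le => /= e e0.
have e4 : 0 < e / 4 by rewrite divr_gt0.
have [N _ /(_ N (leqnn N)) /= HN] := (cvgrPdist_le _ _).1 cU _ e4.
near=> n.
have Hn : `|p * pr (FN N) - pr (FN N `&` Z n)| <= e / 4.
  by near: n; have /cvgrPdist_le := cFN N; apply.
have mUZ : measurable ((\bigcup_k F k) `&` Z n) by exact: measurableI.
have mFZ : measurable (FN N `&` Z n) by exact: measurableI.
have mD : measurable (~` FN N `&` \bigcup_k F k).
  by apply: measurableI => //; exact: measurableC.
have rest : pr (~` FN N `&` \bigcup_k F k) = pr (\bigcup_k F k) - pr (FN N).
  by rewrite prIC// (_ : FN N `&` _ = FN N)//; apply/setIidPl.
have h1 : pr (FN N `&` Z n) <= pr ((\bigcup_k F k) `&` Z n).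
  by apply: pr_le => //; exact: setSI.
have h2 : pr ((\bigcup_k F k) `&` Z n) <= pr (FN N `&` Z n) + pr (~` FN N `&` \bigcup_k F k).
  rewrite -prU//; last by rewrite setIACA setICr set0I.
  apply: pr_le => //; first exact: measurableU.
  move=> t [Ut Zt]; have [Ft|Ft] := pselect (FN N t); first by left.
  by right.
have h3 : 0 <= pr (\bigcup_k F k) - pr (FN N) by rewrite -rest pr_ge0.
rewrite rest in h2.
have h4 : p * (pr (\bigcup_k F k) - pr (FN N)) <= pr (\bigcup_k F k) - pr (FN N).
  by rewrite ler_piMl.
have h5 : 0 <= p * (pr (\bigcup_k F k) - pr (FN N)) by rewrite mulr_ge0.
move: HN Hn; rewrite !ler_norml mulrBr in h4 h5 *.
lra.
Unshelve. all: by end_near. Qed.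

End mixing_class.

(** * Products of rays generate the Borel sets of the plane *)

Section rays.
Context {R : realType}.

(** The endpoint +oo gives the whole line, so that products of rays include
    strips and the whole plane. *)
Definition ray (a : \bar R) : set (measurableTypeR R) := [set y | (y%:E < a)%E].

Definition quadrant : set (set (plane R)) :=
  [set C | exists a a', C = ray a `*` ray a'].

Lemma ray_fin (a : R) : ray a%:E = `]-oo, a[%classic.
Proof. by apply/seteqP; split=> y /=; rewrite /ray/= in_itv/= lte_fin. Qed.

Lemma ray_setT : ray +oo = setT.
Proof. by apply/seteqP; split=> y //= _; rewrite /ray/= ltry. Qed.

Lemma measurable_ray a : measurable (ray a).
Proof.
case: a => [a| |]; first by rewrite ray_fin; exact: measurable_itv.
  by rewrite ray_setT; exact: measurableT.
by rewrite (_ : ray -oo = set0)//; apply/seteqP; split=> y.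
Qed.

Lemma rayI a b : ray a `&` ray b = ray (Order.min a b).
Proof.
apply/seteqP; split=> y /=; rewrite /ray/= lt_min; first by case=> -> ->.
by move=> /andP[].
Qed.

Lemma quadrant_setI : setI_closed quadrant.
Proof.
move=> _ _ [a [a' ->]] [b [b' ->]]; exists (Order.min a b), (Order.min a' b').
by rewrite -setXI !rayI.
Qed.

(** The rays generate the Borel sets; the closure under countable unions is
    asked for all families, not only for disjoint ones. *)
Lemma ray_induction (S : set (set (measurableTypeR R))) :
  (forall a, S (ray a)) -> (forall A, S A -> S (~` A)) ->
  (forall F : (set (measurableTypeR R))^nat, (forall n, S (F n)) -> S (\bigcup_n F n)) ->
  forall A, measurable A -> S A.
Proof.
move=> Sray SC SU A mA.
move: mA; rewrite -[measurable]/((@ocitv R).-sigma.-measurable) RGenInftyO.measurableE.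
suff H : <<s @RGenInftyO.G R >> `<=` S by exact: H.
apply: smallest_sub; last by move=> _ [x ->]; rewrite -ray_fin; exact: Sray.
have S0 : S set0.
  by rewrite -setCT -ray_setT; apply: SC; exact: Sray.
split => //; first by move=> B SB; rewrite setTD; exact: SC.
Qed.

Lemma measurable_quadrant : @measurable _ (plane R) = <<s quadrant >>.
Proof.
apply/seteqP; split; last first.
  apply: smallest_sub; first exact: sigma_algebra_measurable.
  by move=> _ [a [a' ->]]; apply: measurableX; exact: measurable_ray.
rewrite measurable_prod_measurableType.
apply: smallest_sub; first exact: smallest_sigma_algebra.
have qC (A : set (plane R)) : <<s quadrant >> A -> <<s quadrant >> (~` A).
  exact: sigma_algebraC.
have qI (A B : set (plane R)) : <<s quadrant >> A -> <<s quadrant >> B ->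
    <<s quadrant >> (A `&` B).
  exact: (@measurableI _ (g_sigma_algebraType quadrant)).
have qU (F : (set (plane R))^nat) : (forall n, <<s quadrant >> (F n)) ->
    <<s quadrant >> (\bigcup_n F n).
  exact: sigma_algebra_bigcup.
have qray a a' : <<s quadrant >> (ray a `*` ray a').
  by apply: sub_gen_smallest; exists a, a'.
have qleft A a' : measurable A -> <<s quadrant >> (A `*` ray a').
  move: A; apply: (ray_induction (S := [set A | <<s quadrant >> (A `*` ray a')])) => //=.
  - move=> A qA; rewrite (_ : ~` A `*` ray a' = (ray +oo `*` ray a') `&` ~` (A `*` ray a')).
      by apply: qI => //; exact: qC.
    rewrite ray_setT; apply/seteqP; split=> -[u y] /=; first by move=> [Au ay]; split => // -[].
    by move=> [[_ ay] H]; split => // Au; exact: H.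
  - by move=> F qF; rewrite setX_bigcupl; exact: qU.
move=> _ [A mA [B mB <-]]; move: B mB.
apply: (ray_induction (S := [set B | <<s quadrant >> (A `*` B)])) => /=.
- by move=> a; exact: qleft.
- move=> B qB; rewrite (_ : A `*` ~` B = (A `*` ray +oo) `&` ~` (A `*` B)).
    by apply: qI; [exact: qleft|exact: qC].
  rewrite ray_setT; apply/seteqP; split=> -[u y] /=; first by move=> [Au ay]; split => // -[].
  by move=> [[Au _] H]; split => // By; exact: H.
- by move=> F qF; rewrite setX_bigcupr; exact: qU.
Qed.

End rays.

(** * The area preserving map on coin sequences *)

Section coin_baker.
Context {R : realType}.
Local Notation P := (@coin R).
Local Notation m := (P \x P)%E.
Local Notation line := (measurableTypeR R).
Local Notation prc := (pr (@coin R)).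
Local Notation prm := (pr (P \x P)%E).

Lemma prc_eq (A B : set line) :
  (forall u, -1 <= u < 1 -> A u <-> B u) -> prc A = prc B.
Proof. by move=> AB; congr fine; exact: coin_eq. Qed.

Lemma measurable_branch1 : measurable_fun setT (branch1 : line -> line).
Proof. by apply: measurable_funM => //; apply: measurable_funD. Qed.

Lemma measurable_branch2 : measurable_fun setT (branch2 : line -> line).
Proof. by apply: measurable_funM => //; apply: measurable_funB. Qed.

Lemma measurable_pre (f : line -> line) (A : set line) :
  measurable_fun setT f -> measurable A -> measurable (f @^-1` A).
Proof. by move=> mf mA; rewrite -[_ @^-1` _]setTI; exact: mf. Qed.

Lemma prc_split (A : set line) : measurable A ->
  prc A = 2^-1 * prc (branch1 @^-1` A) + 2^-1 * prc (branch2 @^-1` A).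
Proof.
move=> mA; apply: EFin_inj; rewrite EFinD !EFinM -!prE//; first exact: coin_split.
- exact: measurable_pre measurable_branch2 mA.
- exact: measurable_pre measurable_branch1 mA.
Qed.

Definition upper (V : set line) : set line := [set y | 0 <= y /\ V (dbl y)].
Definition lower (V : set line) : set line := [set y | y < 0 /\ V (dbl y)].

Lemma measurable_upper V : measurable V -> measurable (upper V).
Proof.
move=> mV; apply: measurableI; first exact: measurable_halfline.
exact: measurable_pre measurable_dbl mV.
Qed.

Lemma measurable_lower V : measurable V -> measurable (lower V).
Proof.
move=> mV; rewrite (_ : lower V = ~` [set y | 0 <= y] `&` dbl @^-1` V).
  apply: measurableI; first by apply: measurableC; exact: measurable_halfline.
  exact: measurable_pre measurable_dbl mV.
by apply/seteqP; split=> y [y0 Vy]; split => //; move: y0; rewrite /= ltNge => /negP.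
Qed.

Lemma prc_upper V : measurable V -> prc (upper V) = 2^-1 * prc V.
Proof.
move=> mV; rewrite prc_split; last exact: measurable_upper.
rewrite (prc_eq (B := V)); last first.
  move=> u /andP[u1 _]; rewrite /upper/=; have [h ->] := dbl_branch1 u1.
  by rewrite h; split=> [[]|].
rewrite [X in _ + _ * X](prc_eq (B := set0)) ?pr_set0 ?mulr0 ?addr0//.
move=> u /andP[_ u1]; rewrite /upper/=; have [h _] := dbl_branch2 u1.
by rewrite h; split=> [[]|].
Qed.

Lemma prc_lower V : measurable V -> prc (lower V) = 2^-1 * prc V.
Proof.
move=> mV; rewrite prc_split; last exact: measurable_lower.
rewrite (prc_eq (B := set0)) ?pr_set0 ?mulr0 ?add0r; last first.
  move=> u /andP[u1 _]; rewrite /lower/= ltNge; have [h _] := dbl_branch1 u1.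
  by rewrite h; split=> [[]|].
congr (_ * _); apply: prc_eq.
move=> u /andP[_ u1]; rewrite /lower/= ltNge; have [h ->] := dbl_branch2 u1.
by rewrite h; split=> [[]|].
Qed.

(** The baker's map with both ratios 1/2: seen on coin sequences, the first toss
    of the second coordinate is removed and prefixed to the first
    coordinate. *)
Definition coin_baker (p : plane R) : plane R :=
  (if 0 <= p.2 then branch1 p.1 else branch2 p.1, dbl p.2).

Lemma measurable_coin_baker : measurable_fun setT coin_baker.
Proof.
apply/measurable_fun_pairP; split.
  apply: measurable_fun_ifT => /=.
  - apply: (measurable_fun_bool true); rewrite setTI.
    rewrite (_ : _ @^-1` _ = setT `*` [set y : line | 0 <= y]).
      by apply: measurableX => //; exact: measurable_halfline.
    by apply/seteqP; split=> -[u y] //= [].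
  - exact: (measurableT_comp measurable_branch1 measurable_fst).
  - exact: (measurableT_comp measurable_branch2 measurable_fst).
exact: (measurableT_comp measurable_dbl measurable_snd).
Qed.

Lemma measurable_coin_baker_pre E : measurable E -> measurable (coin_baker @^-1` E).
Proof. by move=> mE; rewrite -[_ @^-1` _]setTI; exact: measurable_coin_baker. Qed.

Lemma coin_baker_preX (U V : set line) : coin_baker @^-1` (U `*` V) =
  (branch1 @^-1` U `*` upper V) `|` (branch2 @^-1` U `*` lower V).
Proof.
apply/seteqP; split=> -[u y] /=; rewrite /coin_baker/= /upper /lower/=.
  by case: leP => y0 [Uu Vy]; [left|right].
by case=> -[Uu [y0 Vy]]; [rewrite y0|rewrite leNgt y0].
Qed.

Lemma coin_baker_dis (U U' V : set line) : (U `*` upper V) `&` (U' `*` lower V) = set0.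
Proof.
by apply/seteqP; split=> -[u y] //= [[_ [y0 _]] [_ [y1 _]]]; rewrite ltNge y0 in y1.
Qed.

Lemma prmX (U V : set line) : measurable U -> measurable V ->
  prm (U `*` V) = prc U * prc V.
Proof.
move=> mU mV; apply: EFin_inj; rewrite EFinM -!prE//; last exact: measurableX.
exact: product_measure1E.
Qed.

(** On a rectangle U * V both halves of the preimage factorise, and the sum is
    the self-similarity [prc_split] of the first coordinate. *)
Lemma coin_baker_preserves (E : set (plane R)) : measurable E -> m (coin_baker @^-1` E) = m E.
Proof.
move=> mE; pose m' : probability (plane R) R :=
  distribution m (mfun_Sub (mem_set measurable_coin_baker)).
suff -> : m E = m' E by [].
apply: product_measure_unique => // U V mU mV.
rewrite -[LHS]/(m (coin_baker @^-1` (U `*` V))) coin_baker_preX.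
have mu1 : measurable (branch1 @^-1` U) := measurable_pre measurable_branch1 mU.
have mu2 : measurable (branch2 @^-1` U) := measurable_pre measurable_branch2 mU.
have mv1 := measurable_upper mV; have mv2 := measurable_lower mV.
transitivity (prc U * prc V)%:E; last by rewrite EFinM -!prE.
rewrite prE; last by apply: measurableU; exact: measurableX.
congr _%:E; rewrite prU; [|exact: measurableX..|exact: coin_baker_dis].
rewrite !prmX// prc_upper// prc_lower// (prc_split mU); ring.
Qed.

Lemma prc_ray_low (a : R) : a <= -1 -> prc (ray a%:E) = 0.
Proof.
move=> a1; rewrite (prc_eq (B := set0)) ?pr_set0// => u /andP[u1 _].
by rewrite /ray/= lte_fin; split=> //; rewrite ltNge (le_trans a1 u1).
Qed.

Lemma ray_full (a : R) u : 1 <= a -> -1 <= u < 1 -> ray a%:E u.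
Proof.
by move=> a1 /andP[_ u1]; rewrite /ray/= lte_fin (lt_le_trans u1).
Qed.

Lemma prc_ray_full (a : R) : 1 <= a -> prc (ray a%:E) = 1.
Proof.
move=> a1; rewrite (prc_eq (B := setT)) ?pr_setT// => u uI.
by split=> // _; exact: ray_full.
Qed.

Lemma branch1_ray (a : R) : branch1 @^-1` ray a%:E = ray (2 * a - 1)%:E.
Proof.
by apply/seteqP; split=> u; rewrite /ray/= !lte_fin /branch1 ltr_pdivrMr// mulrC ltrBrDr.
Qed.

Lemma branch2_ray (a : R) : branch2 @^-1` ray a%:E = ray (2 * a + 1)%:E.
Proof.
by apply/seteqP; split=> u; rewrite /ray/= !lte_fin /branch2 ltr_pdivrMr// mulrC ltrBlDr.
Qed.

Lemma prc_ray (a : R) :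
  prc (ray a%:E) = 2^-1 * prc (ray (2 * a - 1)%:E) + 2^-1 * prc (ray (2 * a + 1)%:E).
Proof. by rewrite (prc_split (measurable_ray _)) branch1_ray branch2_ray. Qed.

Lemma measurable_iter n : measurable_fun setT (iter n dbl : line -> line).
Proof.
elim: n => [|n IH]; first exact: measurable_id.
exact: (measurableT_comp measurable_dbl IH).
Qed.

Lemma dbl_preserves V : measurable V -> prc (dbl @^-1` V) = prc V.
Proof.
move=> mV; rewrite prc_split; last exact: measurable_pre measurable_dbl mV.
have -> : prc (branch1 @^-1` (dbl @^-1` V)) = prc V.
  by apply: prc_eq => u /andP[u1 _] /=; have [_ ->] := dbl_branch1 u1.
have -> : prc (branch2 @^-1` (dbl @^-1` V)) = prc V.
  by apply: prc_eq => u /andP[_ u1] /=; have [_ ->] := dbl_branch2 u1.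
by lra.
Qed.

Lemma iter_preserves n V : measurable V -> prc (iter n dbl @^-1` V) = prc V.
Proof.
move=> mV; elim: n => // n IH.
rewrite (_ : _ @^-1` V = dbl @^-1` (iter n dbl @^-1` V)).
  by rewrite dbl_preserves//; exact: measurable_pre (measurable_iter n) mV.
by apply/seteqP; split=> y; rewrite /= -iterSr.
Qed.

(** For one of the two branches the preimage of a ray is trivial, namely empty
    or all of [-1, 1[, and there the two sides agree exactly. The other branch
    has weight 1/2, so the discrepancy is halved with each step. *)
Lemma ray_mixing n (a : R) V : measurable V ->
  `|prc (ray a%:E `&` iter n dbl @^-1` V) - prc V * prc (ray a%:E)| <= (2 ^+ n)^-1.
Proof.
move=> mV.
have mZ k : measurable (iter k dbl @^-1` V) := measurable_pre (measurable_iter k) mV.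
have mI (b : R) k : measurable (ray b%:E `&` iter k dbl @^-1` V).
  exact: (measurableI _ _ (measurable_ray b%:E) (mZ k)).
have V0 := pr_ge0 (@coin R) V; have V1 := pr_le1 (@coin R) mV.
elim: n a => [|n IH] a.
  rewrite expr0 invr1.
  have r0 := pr_ge0 (@coin R) (ray a%:E); have r1 := pr_le1 (@coin R) (measurable_ray a%:E).
  have q0 := pr_ge0 (@coin R) (ray a%:E `&` iter 0 dbl @^-1` V).
  have q1 := pr_le1 (@coin R) (mI a 0%N).
  have := mulr_ge0 V0 r0; have := mulr_ile1 V0 r0 V1 r1.
  move: (_ * _) (prc _) q0 q1 => p q q0 q1 p1 p0.
  by rewrite ler_norml; apply/andP; split; lra.
have step : prc (ray a%:E `&` iter n.+1 dbl @^-1` V) =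
    2^-1 * prc (ray (2 * a - 1)%:E `&` iter n dbl @^-1` V) +
    2^-1 * prc (ray (2 * a + 1)%:E `&` iter n dbl @^-1` V).
  rewrite prc_split//; congr (_ * _ + _ * _); apply: prc_eq => u /andP[u1 u2].
    rewrite -branch1_ray /preimage/= -iterS iterSr.
    by have [_ ->] := dbl_branch1 u1.
  rewrite -branch2_ray /preimage/= -iterS iterSr.
  by have [_ ->] := dbl_branch2 u2.
have low (b : R) : b <= -1 -> prc (ray b%:E `&` iter n dbl @^-1` V) = 0.
  move=> b1; apply/eqP; rewrite eq_le pr_ge0 andbT -(prc_ray_low b1).
  by apply: pr_le => //; exact: measurable_ray.
have full (b : R) : 1 <= b -> prc (ray b%:E `&` iter n dbl @^-1` V) = prc V.
  move=> b1; rewrite -(iter_preserves n mV); apply: prc_eq => u uI.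
  by split=> [[]//|h]; split => //; exact: ray_full.
rewrite step prc_ray exprS invfM.
have := IH (2 * a - 1); have := IH (2 * a + 1).
have [a0|a0] := leP a 0.
  have a1 : 2 * a - 1 <= -1 by lra.
  rewrite (low _ a1) (prc_ray_low a1) => H _.
  rewrite !mulr0 !add0r mulrCA -mulrBr normrM ger0_norm ?invr_ge0//.
  by rewrite ler_wpM2l// invr_ge0.
have a1 : 1 <= 2 * a + 1 by lra.
rewrite (full _ a1) (prc_ray_full a1) => _ H.
rewrite mulr1 mulrDr opprD addrACA (mulrC _ 2^-1) subrr addr0.
rewrite mulrCA -mulrBr normrM ger0_norm ?invr_ge0//.
by rewrite ler_wpM2l// invr_ge0.
Qed.

End coin_baker.

(** * Ergodicity on coin sequences *)

Section ergodic.
Context {R : realType}.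
Local Notation P := (@coin R).
Local Notation m := (P \x P)%E.
Local Notation line := (measurableTypeR R).
Local Notation prc := (pr (@coin R)).
Local Notation prm := (pr (P \x P)%E).

Lemma prc_itv01 (V : set line) : measurable V -> 0 <= prc V <= 1.
Proof. by move=> mV; rewrite pr_ge0 pr_le1. Qed.

Lemma dist_le (x y z : R) : 0 <= x <= z -> 0 <= y <= z -> `|x - y| <= z.
Proof.
move=> /andP[x0 xz] /andP[y0 yz].
by rewrite ler_norml; apply/andP; split; lra.
Qed.

Lemma tail_mixing (V : set line) C : measurable V -> measurable C ->
  prm (C `&` (setT `*` (iter n dbl @^-1` V))) @[n --> \oo] --> prc V * prm C.
Proof.
move=> mV; have mZ n : measurable (iter n dbl @^-1` V : set line).
  exact: measurable_pre (measurable_iter n) mV.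
apply: (mixing_class (G := quadrant) (p := prc V)).
- exact: measurable_quadrant.
- exact: quadrant_setI.
- exact: prc_itv01.
- by move=> n; apply: measurableX.
- under eq_fun => n do rewrite prmX// iter_preserves// pr_setT mul1r.
  exact: cvg_cst.
move=> _ [a [a' ->]].
have -> : (fun n => prm (ray a `*` ray a' `&` setT `*` (iter n dbl @^-1` V))) =
    (fun n => prc (ray a) * prc (ray a' `&` iter n dbl @^-1` V)).
  apply/funext => n; rewrite -setXI setIT prmX//; first exact: measurable_ray.
  by apply: measurableI => //; exact: measurable_ray.
rewrite prmX; [|exact: measurable_ray..].
rewrite mulrCA; apply: cvgMl_tmp.
case: a' => [a'| |].
- apply/cvgrPdist_le => /= e e0.
  have c : (fun n => (2^-1 : R) ^+ n) @ \oo --> (0 : R).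
    by apply: cvg_expr; rewrite ger0_norm; lra.
  have /cvgrPdist_le/(_ _ e0) := c; apply: filterS => n.
  rewrite sub0r normrN exprVn ger0_norm ?invr_ge0 ?exprn_ge0// => H.
  by rewrite distrC; apply: le_trans H; exact: ray_mixing.
- rewrite ray_setT pr_setT mulr1; under eq_fun => n do rewrite setTI iter_preserves//.
  exact: cvg_cst.
- have -> : ray -oo = set0 :> set line by apply/seteqP; split=> y.
  rewrite pr_set0 mulr0; under eq_fun => n do rewrite set0I pr_set0.
  exact: cvg_cst.
Qed.

(** Invariance of A up to a null set, in the form in which it is used: A does
    not distinguish a set from its preimage. *)
Variable A : set (plane R).
Hypothesis mA : measurable A.
Hypothesis invA : forall E, measurable E -> m (A `&` coin_baker @^-1` E) = m (A `&` E).

Let prm_inv E : measurable E -> prm (A `&` coin_baker @^-1` E) = prm (A `&` E).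
Proof. by move=> mE; congr fine; exact: invA. Qed.

Let p := prm A.

(** By invariance V can be replaced by its preimage under any iterate of
    [dbl], and these preimages become independent of A. *)
Lemma invariant_tail (V : set line) : measurable V -> prm (A `&` setT `*` V) = p * prc V.
Proof.
move=> mV.
have cst n : prm (A `&` (setT `*` (iter n dbl @^-1` V))) = prm (A `&` setT `*` V).
  elim: n => [|n IH]; first exact: erefl.
  rewrite -IH -(prm_inv (E := setT `*` (iter n dbl @^-1` V))).
    congr (prm (_ `&` _)); apply/seteqP.
    by split=> -[u y] /= [_]; rewrite -iterS iterSr.
  by apply: measurableX => //; exact: measurable_pre (measurable_iter n) mV.
have := tail_mixing mV mA; under eq_fun => n do rewrite cst.
move=> c; rewrite mulrC; apply: (cvg_unique _ _ c) => //=; exact: cvg_cst.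
Qed.

Let mAX (U V : set line) : measurable U -> measurable V -> measurable (A `&` U `*` V).
Proof. by move=> mU mV; apply: measurableI => //; exact: measurableX. Qed.

Lemma invariant_split (a : R) (V : set line) : measurable V ->
  prm (A `&` ray a%:E `*` V) =
  prm (A `&` ray (2 * a - 1)%:E `*` upper V) + prm (A `&` ray (2 * a + 1)%:E `*` lower V).
Proof.
move=> mV; rewrite -prm_inv; last by apply: measurableX => //; exact: measurable_ray.
rewrite coin_baker_preX branch1_ray branch2_ray setIUr prU//.
- by apply: mAX; [exact: measurable_ray|exact: measurable_upper].
- by apply: mAX; [exact: measurable_ray|exact: measurable_lower].
- by rewrite setIACA coin_baker_dis setI0.
Qed.

Lemma invariant_low (a : R) (V : set line) : measurable V -> a <= -1 ->
  prm (A `&` ray a%:E `*` V) = 0.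
Proof.
move=> mV a1; apply/eqP; rewrite eq_le pr_ge0 andbT.
have mr := @measurable_ray R a%:E.
apply: (@le_trans _ _ (prm (ray a%:E `*` V))).
  by apply: pr_le => //; [exact: mAX|exact: measurableX].
by rewrite prmX// prc_ray_low// mul0r.
Qed.

Lemma invariant_full (a : R) (V : set line) : measurable V -> 1 <= a ->
  prm (A `&` ray a%:E `*` V) = p * prc V.
Proof.
move=> mV a1; rewrite -(invariant_tail mV).
have mr := @measurable_ray R a%:E; have mrC : measurable (~` ray a%:E : set line).
  exact: measurableC.
apply/eqP; rewrite eq_le; apply/andP; split.
  apply: pr_le; [exact: mAX|exact: mAX|].
  by move=> -[u y] [Auy [_ Vy]].
have -> : prm (A `&` ray a%:E `*` V) =
    prm (A `&` ray a%:E `*` V) + prm (~` ray a%:E `*` V).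
  rewrite prmX// (prc_eq (B := set0)) ?pr_set0 ?mul0r ?addr0// => u uI.
  by split=> //; apply; exact: ray_full.
rewrite -prU; first last.
- by apply/seteqP; split=> -[u y] //= [[_ [H _]] [H' _]].
- exact: measurableX.
- exact: mAX.
apply: pr_le; [exact: mAX|by apply: measurableU; [exact: mAX|exact: measurableX]|].
move=> -[u y] [Auy [_ Vy]]; have [Hu|Hu] := pselect (ray a%:E u); first by left.
by right.
Qed.

(** The step [invariant_split] replaces the rectangle by two, each with half of
    V. One of the two new rays is trivial: if it is null both sides vanish, if
    it is full they agree by [invariant_tail]. So the discrepancy, at most the
    probability of V, is halved with each step. *)
Lemma invariant_ray k (a : R) (V : set line) : measurable V ->
  `|prm (A `&` ray a%:E `*` V) - p * (prc (ray a%:E) * prc V)| <= (2 ^+ k)^-1 * prc V.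
Proof.
elim: k a V => [|k IH] a V mV.
  have mr := @measurable_ray R a%:E.
  have V0 := pr_ge0 (@coin R) V.
  have h0 := pr_ge0 m (A `&` ray a%:E `*` V).
  have h1 : prm (A `&` ray a%:E `*` V) <= prc V.
    apply: (@le_trans _ _ (prm (setT `*` V))).
      by apply: pr_le; [exact: mAX|exact: measurableX|move=> -[u y] [_ []]].
    by rewrite prmX// pr_setT mul1r.
  have p0 : 0 <= p := pr_ge0 m A. 
  have p1 : p <= 1 := pr_le1 m mA.
  have r0 := pr_ge0 (@coin R) (ray a%:E); have r1 := pr_le1 (@coin R) mr.
  have pr1 : p * prc (ray a%:E) <= 1 by rewrite mulr_ile1.
  have pr0 : 0 <= p * prc (ray a%:E) by rewrite mulr_ge0.
  have g1 : p * (prc (ray a%:E) * prc V) <= prc V by rewrite mulrA ler_piMl.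
  have g0 : 0 <= p * (prc (ray a%:E) * prc V) by rewrite mulrA mulr_ge0.
  by rewrite expr0 invr1 mul1r dist_le ?h0 ?h1 ?g0 ?g1.
have mU := measurable_upper mV; have mL := measurable_lower mV.
have IH1 := IH (2 * a - 1) _ mU; have IH2 := IH (2 * a + 1) _ mL.
rewrite invariant_split// prc_ray exprS invfM.
move: IH1 IH2; rewrite prc_upper// prc_lower//.
have [a0|a0] := leP a 0.
  have a1 : 2 * a - 1 <= -1 by lra.
  rewrite (invariant_low mU a1) (prc_ray_low a1) => _ H.
  rewrite [X in `|X|](_ : _ = prm (A `&` ray (2 * a + 1)%:E `*` lower V) -
    p * (prc (ray (2 * a + 1)%:E) * (2^-1 * prc V))); last by ring.
  by rewrite [leRHS](_ : _ = (2 ^+ k)^-1 * (2^-1 * prc V))//; ring.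
have a1 : 1 <= 2 * a + 1 by lra.
rewrite (invariant_full mL a1) (prc_ray_full a1) prc_lower// => H _.
rewrite [X in `|X|](_ : _ = prm (A `&` ray (2 * a - 1)%:E `*` upper V) -
  p * (prc (ray (2 * a - 1)%:E) * (2^-1 * prc V))); last by ring.
by rewrite [leRHS](_ : _ = (2 ^+ k)^-1 * (2^-1 * prc V))//; ring.
Qed.

(** A is independent of all products of rays, hence of all Borel sets, and in
    particular of itself. *)
Lemma coin_baker_ergodic : m A = 0%E \/ m A = 1%E.
Proof.
have key C : measurable C -> prm (C `&` A) = p * prm C.
  move=> mC.
  have c : prm (C `&` A) @[n --> \oo] --> p * prm C.
    apply: (mixing_class (G := quadrant) (p := p) (Z := fun=> A)) => //.
    - exact: measurable_quadrant.
    - exact: quadrant_setI.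
    - by rewrite /p pr_ge0 pr_le1.
    - exact: cvg_cst.
    move=> _ [a [a' ->]].
    rewrite prmX; [|exact: measurable_ray..].
    suff -> : prm (ray a `*` ray a' `&` A) = p * (prc (ray a) * prc (ray a')).
      exact: cvg_cst.
    rewrite setIC; have mr := @measurable_ray R a'.
    case: a => [a| |].
    - apply/eqP; rewrite -subr_eq0 -normr_le0.
      have c : (fun k => (2^-1 : R) ^+ k) @ \oo --> (0 : R).
        by apply: cvg_expr; rewrite ger0_norm; lra.
      rewrite -(cvg_lim _ c)//; apply: limr_ge; first by apply/cvg_ex; eexists; exact: c.
      apply: nearW => k; rewrite exprVn; apply: le_trans (invariant_ray k a mr) _.
      by rewrite ler_piMr ?invr_ge0 ?exprn_ge0// pr_le1.
    - by rewrite ray_setT invariant_tail// pr_setT mul1r.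
    - have -> : ray -oo = set0 :> set line by apply/seteqP; split=> y.
      by rewrite set0X setI0 !pr_set0 mul0r mulr0.
  by apply: (cvg_unique _ _ c) => //=; exact: cvg_cst.
have /eqP := key A mA; rewrite setIid -/p -subr_eq0 -{1}[p]mulr1 -mulrBr mulf_eq0.
rewrite (prE _ mA) -/p subr_eq0 => /orP[/eqP ->|/eqP <-]; first by left.
by right.
Qed.

End ergodic.

(** * The invariant measure *)

Section factor.
Context {R : realType}.
Local Notation P := (@coin R).
Local Notation m := (P \x P)%E.
Local Notation leb := (@lebesgue_measure R).
Local Notation line := (measurableTypeR R).
Variables b1 b2 : R.
Hypotheses (b1I : 0 < b1 <= 649 / 1000) (b2I : 0 < b2 <= 649 / 1000).

Definition factor (p : plane R) : plane R := (coded_point b1 b2 p.1, p.2).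

Lemma measurable_factor : measurable_fun setT factor.
Proof.
apply/measurable_fun_pairP; split; last exact: measurable_snd.
exact: (measurableT_comp (measurable_coded_point b1I b2I) measurable_fst).
Qed.

Lemma measurable_baker : measurable_fun setT (baker b1 b2).
Proof.
apply: measurable_fun_ifT => /=.
- apply: (measurable_fun_bool true); rewrite setTI.
  rewrite (_ : _ @^-1` _ = setT `*` [set y : line | 0 <= y]).
    by apply: measurableX => //; exact: measurable_halfline.
  by apply/seteqP; split=> -[u y] //= [].
- apply/measurable_fun_pairP; split.
    apply: measurable_funD => //; apply: measurable_funM => //; exact: measurable_fst.
  apply: measurable_funB => //; apply: measurable_funM => //; exact: measurable_snd.
- apply/measurable_fun_pairP; split.
    apply: measurable_funB => //; apply: measurable_funM => //; exact: measurable_fst.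
  apply: measurable_funD => //; apply: measurable_funM => //; exact: measurable_snd.
Qed.

(** Prefixing a toss to a coin sequence applies the corresponding contraction
    to the coded point. *)
Lemma factor_coin_baker (p : plane R) : -1 <= p.1 < 1 ->
  factor (coin_baker p) = baker b1 b2 (factor p).
Proof.
case: p => u y /= /andP[u1 u2].
rewrite /factor /coin_baker /baker/= {1}/dbl (coded_point_step b1I b2I).
case: (0 <= y); first by have [-> ->] := dbl_branch1 u1.
by have [-> ->] := dbl_branch2 u2.
Qed.

Lemma factor_square (p : plane R) : -1 <= p.2 < 1 -> square (factor p).
Proof.
move=> /andP[y0 y1]; split; rewrite /= in_itv/=; first exact: coded_point_itv.
by rewrite y0 ltW.
Qed.

Definition baker_measure : probability (plane R) R :=
  distribution m (mfun_Sub (mem_set measurable_factor)).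

Lemma baker_measureE A : baker_measure A = m (factor @^-1` A).
Proof. by []. Qed.

Lemma product_coin_eq (A B : set (plane R)) : measurable A -> measurable B ->
  (forall p, -1 <= p.1 < 1 -> -1 <= p.2 < 1 -> A p <-> B p) -> m A = m B.
Proof.
move=> mA mB AB.
pose X : set (plane R) := unit_itv `*` unit_itv.
have mu := @measurable_unit_itv R.
have mX : measurable X by exact: measurableX.
have X0 : m (~` X) = 0%E.
  have -> : m (~` X) = (1 - m X)%E by exact: probability_setC.
  have Pu : P unit_itv = 1%E.
    rewrite -(@coin_setT R); exact: coin_eq.
  have -> : m X = (P unit_itv * P unit_itv)%E by exact: product_measure1E.
  by rewrite Pu mule1 subee.
have mAX C : measurable C -> m C = m (C `&` X).
  move=> mC; rewrite -[in LHS](setUIDK C X) measureU ?setIDAC//.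
  - rewrite [X in (_ + X)%E](_ : _ = 0%E) ?adde0//.
    apply/eqP; rewrite -measure_le0 -X0; apply: le_measure; rewrite ?inE.
    + exact: measurableD.
    + exact: measurableC.
    + by move=> p [].
  - exact: measurableI.
  - exact: measurableD.
  - by rewrite setDE setIACA setICr setI0.
rewrite (mAX _ mA) (mAX _ mB); congr (m _); apply/seteqP; split=> p [Hp Xp];
split=> //; case: Xp; rewrite /unit_itv/= !in_itv/= => p1 p2; exact/AB.
Qed.

Lemma measurable_factor_pre A : measurable A -> measurable (factor @^-1` A).
Proof. by move=> mA; rewrite -[_ @^-1` _]setTI; exact: measurable_factor. Qed.

Lemma measurable_square : measurable (@square R).
Proof. by apply: measurableX; exact: measurable_itv. Qed.

Lemma measurable_baker_pre A : measurable A ->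
  measurable (@square R `&` baker b1 b2 @^-1` A).
Proof.
move=> mA; apply: measurableI; first exact: measurable_square.
by rewrite -[_ @^-1` _]setTI; exact: measurable_baker.
Qed.

Lemma baker_measure_ergodic : ergodic_measure_on (@square R) (baker b1 b2) baker_measure.
Proof.
split.
- rewrite baker_measureE (product_coin_eq (B := setT)) ?probability_setT//.
    by apply: measurable_factor_pre; exact: measurable_square.
  by move=> p _ p2; split=> // _; exact: factor_square.
- move=> A mA AX; rewrite !baker_measureE.
  rewrite -[RHS]coin_baker_preserves; last exact: measurable_factor_pre.
  apply: product_coin_eq.
  + by apply: measurable_factor_pre; exact: measurable_baker_pre.
  + by apply: measurable_coin_baker_pre; exact: measurable_factor_pre.
  move=> p p1 p2; rewrite /preimage/= factor_coin_baker//.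
  by split=> [[]//|h]; split=> //; exact: factor_square.
- move=> A mA AX invA; rewrite !baker_measureE.
  have mA' := measurable_factor_pre mA.
  apply: (coin_baker_ergodic mA') => E mE.
  rewrite -[RHS]coin_baker_preserves; last exact: measurableI.
  apply: product_coin_eq.
  + by apply: measurableI => //; exact: measurable_coin_baker_pre.
  + by apply: measurable_coin_baker_pre; exact: measurableI.
  move=> p p1 p2; rewrite preimage_setI /setI/preimage/= factor_coin_baker//.
  have -> : A (factor p) <-> A (baker b1 b2 (factor p)).
    rewrite -{1}invA; split=> [[]//|h]; split=> //; exact: factor_square.
  by [].
Qed.

(** Almost every horizontal section of a null set is null. *)
Lemma baker_measure_ac :
  (forall N : set line, measurable N -> leb N = 0%E -> P (coded_point b1 b2 @^-1` N) = 0%E) ->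
  baker_measure `<< lebesgue2 R.
Proof.
move=> nullP; apply/null_content_dominatesP => E mE E0.
have mE' := measurable_factor_pre mE.
rewrite baker_measureE.
have -> : m (factor @^-1` E) = (P \x^ P)%E (factor @^-1` E).
  by apply: product_measure_unique => // U V mU mV; exact: product_measure2E.
have {}E0 : (leb \x^ leb)%E E = 0%E.
  rewrite -E0; apply/esym; apply: product_measure_unique => // U V mU mV.
  exact: product_measure2E.
have ms : measurable_fun setT (leb \o ysection E) by exact: measurable_fun_ysection.
have ms' : measurable_fun setT (P \o ysection (factor @^-1` E)).
  exact: measurable_fun_ysection.
have aeleb : ae_eq leb setT (leb \o ysection E) (cst 0%E).
  apply/(ae_eq_integral_abs leb measurableT ms).
  rewrite -[RHS]E0; apply: eq_integral => y _.
  by rewrite gee0_abs.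
have aeP : ae_eq P setT (leb \o ysection E) (cst 0%E).
  case: aeleb => W [mW W0 HW]; exists W; split=> //; exact: coin_dominated.
rewrite /product_measure2 (ae_eq_integral (cst 0%E))//; first exact: integral0.
apply: filterS aeP => y /(_ I)/= y0 _.
rewrite (_ : ysection _ y = coded_point b1 b2 @^-1` ysection E y).
  exact: (nullP _ (measurable_ysection y mE) y0).
by apply/seteqP; split=> u; rewrite /ysection/= !inE.
Qed.

End factor.

(** * Almost all parameters *)

Section parameters.
Context {R : realType}.
Local Notation leb := (@lebesgue_measure R).
Local Notation line := (measurableTypeR R).

Definition code_law_ac (b : plane R) := forall N : set line, measurable N -> leb N = 0%E ->
  coin (coded_point b.1 b.2 @^-1` N) = 0%E.

Lemma ae_code_law_ac_box (l1 l2 : R) : 1 / 4 <= l1 -> 1 / 4 <= l2 -> 1 / 4 < l1 * l2 ->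
  {ae lebesgue2 R, forall b, l1 <= b.1 <= 649 / 1000 -> l2 <= b.2 <= 649 / 1000 -> code_law_ac b}.
Proof.
move=> l10 l20 l12.
have l1p : 0 < l1 by lra.
have l2p : 0 < l2 by lra.
have a1 : 0 < (2 * l1)^-1 by rewrite invr_gt0 mulr_gt0.
have a2 : 0 < (2 * l2)^-1 by rewrite invr_gt0 mulr_gt0.
have a12 : (2 * l1)^-1 * (2 * l2)^-1 < 1.
  by rewrite -invfM invf_lt1 ?mulr_gt0//; lra.
have [m [y1 [y2 [y10 y20 y12 E1 E2]]]] := small_roots a1 a2 a12.
have := ae_energy_bound l10 l20 y10 y20 (esym E1) (esym E2).
apply: filterS => b Hb /andP[h1 h1'] /andP[h2 h2'].
have b1I : 0 < b.1 <= 649 / 1000 by rewrite (lt_le_trans l1p h1).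
have b2I : 0 < b.2 <= 649 / 1000 by rewrite (lt_le_trans l2p h2).
apply: (coded_point_null b1I b2I h1 h2 y10 y20 y12) => M.
by have := Hb M; case: (b).
Qed.

(** Each vertical section of the curve has at most one point. *)
Lemma ae_not_hyperbola : {ae lebesgue2 R, forall b, b.1 * b.2 != 1 / 4}.
Proof.
pose H : set (plane R) := [set b | b.1 * b.2 = 1 / 4].
have mH : measurable H.
  have mf : measurable_fun setT (fun b : plane R => b.1 * b.2 : line).
    by apply: measurable_funM; [exact: measurable_fst|exact: measurable_snd].
  rewrite (_ : H = (fun b : plane R => b.1 * b.2) @^-1` [set 1 / 4])//.
  rewrite -[_ @^-1` _]setTI; apply: mf => //; exact: measurable_set1.
exists H; split=> //.
  rewrite /product_measure1 (eq_integral (cst 0%E)) ?integral0// => r _ /=.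
  apply/eqP; rewrite -measure_le0 -(lebesgue_measure_set1 (1 / 4 / r)).
  apply: le_measure; rewrite ?inE; [exact: measurable_xsection|exact: measurable_set1|].
  move=> y; rewrite /xsection/= inE /H/= => e.
  have r0 : r != 0 by apply/eqP => r0; move: e; rewrite r0 mul0r; lra.
  by rewrite -e mulrAC divff// mul1r.
by move=> b /= /negP; rewrite negbK => /eqP.
Qed.

(** The boxes have lower corners (i / (n+1), j / (n+1)). Rounding b down to
    this lattice loses at most 2 / (n+1) in the product of the coordinates,
    which for large n stays above 1/4. *)
Lemma ae_code_law_ac : {ae lebesgue2 R, forall b, 0 < b.1 < 649 / 1000 ->
  0 < b.2 < 649 / 1000 -> 1 / 4 <= b.1 * b.2 -> code_law_ac b}.
Proof.
pose lat (i n : nat) : R := i%:R / n.+1%:R.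
have FF : Filter (almost_everywhere (lebesgue2 R)).
  exact: (ae_filter_ringOfSetsType (lebesgue2 R)).
have H : {ae lebesgue2 R, forall b, forall n i j, 1 / 4 <= lat i n -> 1 / 4 <= lat j n ->
   1 / 4 < lat i n * lat j n ->
   lat i n <= b.1 <= 649 / 1000 -> lat j n <= b.2 <= 649 / 1000 -> code_law_ac b}.
  apply: ae_foralln => n; apply: ae_foralln => i; apply: ae_foralln => j.
  have [h1|h1] := pselect (1 / 4 <= lat i n); last by apply: aeW => b /h1.
  have [h2|h2] := pselect (1 / 4 <= lat j n); last by apply: aeW => b _ /h2.
  have [h3|h3] := pselect (1 / 4 < lat i n * lat j n); last by apply: aeW => b _ _ /h3.
  apply: (@filterS _ _ FF _ _ _ (ae_code_law_ac_box h1 h2 h3)) => b hb _ _ _; exact: hb.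
have := @filterI _ _ FF _ _ H ae_not_hyperbola; apply: (@filterS _ _ FF).
move=> b [Hb bn] /andP[b10 b11] /andP[b20 b21] b12.
have b1x : b.1 <= 1 by apply: le_trans (ltW b11) _; lra.
have b2x : b.2 <= 1 by apply: le_trans (ltW b21) _; lra.
have {}b12 : 1 / 4 < b.1 * b.2 by rewrite lt_neqAle eq_sym bn.
pose e := b.1 * b.2 - 1 / 4.
have e0 : 0 < e by rewrite /e subr_gt0.
pose n := Num.truncn (2 / e).
have n1 : 2 / e < n.+1%:R by exact: truncnS_gt.
have n0 : 0 < n.+1%:R :> R by rewrite ltr0n.
pose d : R := n.+1%:R^-1.
have d0 : 0 < d by rewrite invr_gt0.
have d1 : 2 * d < e by rewrite ltr_pdivrMr// mulrC -ltr_pdivrMr.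
have grid (x : R) : 0 < x -> exists i, lat i n <= x /\ x - d < lat i n.
  move=> x0; exists (Num.truncn (x * n.+1%:R)).
  have xn : 0 <= x * n.+1%:R by apply: mulr_ge0; exact: ltW.
  split; first by rewrite /lat ler_pdivrMr// truncn_le.
  rewrite /lat ltr_pdivlMr// mulrBl mulVf ?gt_eqF// ltrBlDr natr1.
  exact: truncnS_gt.
have [i [i1 i2]] := grid _ b10; have [j [j1 j2]] := grid _ b20.
have i0 : 0 <= lat i n by rewrite divr_ge0.
have j0 : 0 <= lat j n by rewrite divr_ge0.
have prod : 1 / 4 < lat i n * lat j n.
  have h1 : (b.1 - lat i n) * b.2 <= d.
    rewrite -[d]mulr1; apply: ler_pM => //; rewrite ?subr_ge0 ?(ltW b20)//.
    by rewrite lerBlDl -lerBlDr ltW.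
  have h2 : lat i n * (b.2 - lat j n) <= d.
    rewrite -[d]mul1r; apply: ler_pM => //; rewrite ?subr_ge0//.
      exact: le_trans i1 b1x.
    by rewrite lerBlDl -lerBlDr ltW.
  have -> : lat i n * lat j n = b.1 * b.2 - (b.1 - lat i n) * b.2
      - lat i n * (b.2 - lat j n) by ring.
  rewrite -addrA -opprD ltrBrDl -ltrBrDr; apply: le_lt_trans d1.
  by rewrite mulr_natl mulr2n; exact: lerD.
apply: (Hb n i j) => //.
- by apply: ltW; apply: lt_le_trans prod _; rewrite ler_piMr// (le_trans j1).
- by apply: ltW; apply: lt_le_trans prod _; rewrite ler_piMl// (le_trans i1).
- by rewrite i1 ltW.
- by rewrite j1 ltW.
Qed.

End parameters.

Theorem theorem2p2 (R : realType) :
  {ae lebesgue2 R, forall b : plane R,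
    0 < b.1 < 649 / 1000 -> 0 < b.2 < 649 / 1000 ->
    b.1 + b.2 >= 1 -> b.1 * b.2 >= 1 / 4 ->
    exists mu : probability (plane R) R,
      ergodic_measure_on (@square R) (baker b.1 b.2) mu /\
      mu `<< lebesgue2 R}.
Proof.
have FF : Filter (almost_everywhere (lebesgue2 R)).
  exact: (ae_filter_ringOfSetsType (lebesgue2 R)).
apply: (@filterS _ _ FF _ _ _ (@ae_code_law_ac R)) => b Hb b1I b2I _ b12.
have b1I' : 0 < b.1 <= 649 / 1000 by case/andP: b1I => -> /ltW ->.
have b2I' : 0 < b.2 <= 649 / 1000 by case/andP: b2I => -> /ltW ->.
exists (baker_measure b1I' b2I'); split; first exact: baker_measure_ergodic.
by apply: baker_measure_ac; exact: Hb.
Qed.
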